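(* Let $0<q<1$. Then $$\eta_q(2n)=2^{2n-1}(-1)^n\frac{b_{2n}(1/2;q)}{[2n]!}\quad\text{for all } n\in\mathbb{N}_0=\{0,1,2,\dots\},$$ and $$\eta_q(-2n)=0\quad\text{for all } n\in\mathbb{N}=\{1,2,\dots\}.$$
   Context: Fix $0<q<1$. $(x;q)_\infty=\prod_{j\ge 0}(1-xq^j)$, $[n]=\frac{1-q^n}{1-q}$, $[n]!=\prod_{k=1}^n[k]$, $[0]!=1$. $E_q(z)=(-(1-q)z;q)_\infty$ and $e_q(z)=1/((1-q)z;q)_\infty$. $\mathrm{Sin}_q z=\frac{E_q(iz)-E_q(-iz)}{2i}$; all its zeros are real and simple, and $(\xi_k)_{k\ge1}$ denotes its positive zeros in increasing order. $\mathrm{Sin}_q'$ is the ordinary derivative. The function $\eta_q$ is defined for $s\in\mathbb{C}$ by $$\eta_q(s)=-\sum_{k=1}^\infty\frac{1}{\xi_k^s}\frac{1}{\mathrm{Sin}_q'\xi_k}.$$ The $q$-Bernoulli polynomials $b_n(x;q)$ are defined by the expansion near $t=0$ $$\frac{t\,e_q(tx)}{e_q(t/2)E_q(t/2)-1}=\sum_{n\ge0}b_n(x;q)\frac{t^n}{[n]!}.$$ *)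

(* Defs.v *)
From HB Require Import structures.
From mathcomp Require Import all_boot all_order all_algebra.
From mathcomp Require Import all_classical all_reals all_analysis.
From mathcomp.real_closed Require Import complex.

Set Implicit Arguments.
Unset Strict Implicit.
Unset Printing Implicit Defensive.

Import Order.TTheory GRing.Theory Num.Theory.
Import numFieldNormedType.Exports.

Local Open Scope classical_set_scope.
Local Open Scope ring_scope.
Local Open Scope complex_scope.

(* The complex numbers are [R[i]] over an arbitrary [R : realType]; [R[i]^o] is
   the same type, and carries the topology given by the modulus. *)

Section QBernoulli.
Variables (R : realType) (q : R).
Implicit Types (n k : nat) (x z s t : R[i]).

Definition qint n : R := (1 - q ^+ n) / (1 - q).

Definition qfact n : R := \prod_(1 <= k < n.+1) qint k.

Definition qpoch_infty x : R[i] :=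
  limn (fun n => \prod_(0 <= j < n) (1 - x * (q ^+ j)%:C) : R[i]^o).

Definition E_q z : R[i] := qpoch_infty (- ((1 - q)%:C * z)).

Definition e_q z : R[i] := (qpoch_infty ((1 - q)%:C * z))^-1.

Definition Sin_q z : R[i] :=
  (E_q ('i%C * z) - E_q (- ('i%C * z))) / (2%:R * 'i%C).

Definition Sin_q' z : R[i] := derive1 (Sin_q : R[i]^o -> R[i]^o) z.

Definition enumerates_pos_zeros (xi : nat -> R) : Prop :=
  increasing_seq xi /\ range xi = [set r : R | 0 < r /\ Sin_q r%:C = 0].

(* At most one sequence satisfies [enumerates_pos_zeros]. The indices are
   shifted: [pos_zero k] is the (k+1)-st positive zero. *)
Definition pos_zero : nat -> R := xget (fun=> 0) enumerates_pos_zeros.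

Definition cexp z : R[i] :=
  (expR (complex.Re z))%:C *
  (cos (complex.Im z) +i* sin (complex.Im z)).

(* The principal power r ^ s; only meaningful for 0 < r. *)
Definition cpow (r : R) s : R[i] := cexp (s * (ln r)%:C).

Definition eta_q_sum s : nat -> R[i]^o :=
  series (fun k => (cpow (pos_zero k) s)^-1 * (Sin_q' (pos_zero k)%:C)^-1
                   : R[i]^o).

(* Convergence of [eta_q_sum s] must be stated separately, since [limn] is
   total. *)
Definition eta_q s : R[i] := - limn (eta_q_sum s).

(* At t = 0 the generating function has a removable singularity, whence the
   punctured neighbourhood, which may depend on x. *)
Definition qbernoulli_expansion x (b : nat -> R[i]) : Prop :=
  \forall t \near (0 : R[i]^o)^',
    series (fun n => b n * (t ^+ n / (qfact n)%:C) : R[i]^o) @ \oo -->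
      (t * e_q (t * x) / (e_q (t / 2%:R) * E_q (t / 2%:R) - 1) : R[i]^o).

(* At most one sequence satisfies [qbernoulli_expansion x], by uniqueness of
   power series coefficients. *)
Definition qbernoulli n x : R[i] :=
  xget (fun=> 0) (qbernoulli_expansion x) n.

End QBernoulli.

(* Main.v *)
(** With [a j = (1-q) q^j], the partial products [prod_(j<N) (1 + a j z)] equal
    [A_N(-z^2) + z U_N(-z^2)] for real polynomials [A_N, U_N], so that
    [x U_N(x^2)] approximates [Sin_q x]. On the real axis this odd part is
    [r_N(x) sin(theta_N(x))] with [theta_N(x) = sum_(j<N) arctan(a j x)]; hence
    for N = 2M+1 its roots are 0 and the M pairs where theta_N is a multiple of
    pi, and they decrease to the zeros of [Sin_q] as N grows. A Wronskian
    identity bounds the derivative at these roots from below by any given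
    power, uniformly in N. Therefore the Lagrange partial fractions
    [w^n = - U_N(w) sum_k 2 rho_k^(2n) / (S_N'(rho_k) (1 - w / rho_k^2))]
    pass to the limit by dominated convergence. For n > 0 and w = 0 this is
    [eta_q(-2n) = 0]; for n = 0 the geometric series gives
    [z / Sin_q z = sum_n 2 eta_q(2n) z^(2n)], which for z = t / 2i is the
    generating function of [b_n(1/2; q)]. *)

Require Import Defs.
From HB Require Import structures.
From mathcomp Require Import all_boot all_order all_algebra.
From mathcomp Require Import all_classical all_reals all_analysis.
From mathcomp.real_closed Require Import complex.
From mathcomp Require Import ring lra zify.

Set Implicit Arguments.
Unset Strict Implicit.
Unset Printing Implicit Defensive.

Import Order.TTheory GRing.Theory Num.Theory.
Import numFieldNormedType.Exports.
Import Normc.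

Local Open Scope classical_set_scope.
Local Open Scope ring_scope.
Local Open Scope complex_scope.

Local Arguments normc : simpl never.

(** * Limits of complex-valued functions *)

Section ComplexLimits.
Variable R : realType.
Implicit Types (x y z : R[i]).

(** The analysis of the products sees [q] only through weights a_j > 0 with partial sums at most 1.
    The bound on the sums gives |P_N(z)| <= e^|z| and theta_N(x) <= x uniformly in N, hence xi_k >=
    (k+1) pi. The obstacle is s = -2n: the terms then carry xi_k^(2n), so convergence hinges on 1 /
    Sin_q'(xi_k) decaying faster than every power. A product of N factors grows only polynomially,
    so this decay is reached one power at a time, by a bound valid for all large N. Working with
    truncations replaces contour integrals by Lagrange interpolation, which is exact at every level;
    and since the roots are level points of a monotone phase, their reality, enumeration and
    convergence come together. The number of factors is odd because theta_N then tends to M pi +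
    pi/2 at infinity, so every level up to M pi is attained with room to spare. *)

Lemma normrC z : `|z| = (normc z)%:C. Proof. by []. Qed.

Lemma normc_ge0 z : 0 <= normc z.
Proof. by rewrite -lecR -normrC normr_ge0. Qed.

Lemma normcD x y : normc (x + y) <= normc x + normc y.
Proof. exact: le_normcD. Qed.

Lemma normc_opp z : normc (- z) = normc z.
Proof. exact: normcN. Qed.

Lemma normc_distC x y : normc (x - y) = normc (y - x).
Proof. by rewrite -normc_opp opprB. Qed.

Lemma normcR (r : R) : normc r%:C = `|r|.
Proof. by rewrite /normc /= expr0n addr0 sqrtr_sqr. Qed.

Lemma normc_nat n : normc (n%:R : R[i]) = n%:R.
Proof. by rewrite -(rmorph_nat (real_complex R)) normcR ger0_norm. Qed.

Lemma normcX z n : normc (z ^+ n) = normc z ^+ n.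
Proof. by elim: n => [|n IH]; rewrite ?expr0 ?normc1// !exprS normcM IH. Qed.

Lemma normci : normc ('i%C : R[i]) = 1.
Proof. by rewrite /normc /= expr0n expr1n add0r sqrtr1. Qed.

Lemma normc_sum (f : nat -> R[i]) m n :
  normc (\sum_(m <= k < n) f k) <= \sum_(m <= k < n) normc (f k).
Proof.
elim/big_ind2: _ => [|a b c d ab cd|//]; first by rewrite normc0.
exact: le_trans (normcD _ _) (lerD ab cd).
Qed.

Lemma normcB_ge x y : normc x - normc y <= normc (x - y).
Proof. by rewrite lerBlDr (le_trans _ (normcD _ _))// subrK. Qed.

(** The norm of [R[i]^o] takes its values in [R[i]]; this passes to the real-valued [normc], where
    real squeeze arguments apply. *)
Lemma cvgCP {T : Type} {F : set_system T} {FF : Filter F} (f : T -> R[i]^o) (l : R[i]) :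
  f x @[x --> F] --> (l : R[i]^o) <->
  normc (f x - l) @[x --> F] --> (0 : R).
Proof.
split => [/cvgrPdist_le fl|/cvgrPdist_le fl]; apply/cvgrPdist_le => e e0.
  have /fl : 0 < e%:C by rewrite ltcR.
  apply: filterS => t; rewrite normrC lecR.
  by rewrite sub0r normrN ger0_norm ?normc_ge0// normc_distC.
(* The order on [R[i]] compares only numbers with equal imaginary parts, so a positive radius is
   real. *)
have [ei e0'] : e = (complex.Re e)%:C /\ 0 < complex.Re e.
  by move: e0; case: e => a b; rewrite ltcE /= => /andP[/eqP -> ->].
have := fl _ e0'; apply: filterS => t.
rewrite sub0r normrN ger0_norm ?normc_ge0// => h.
by rewrite ei normrC lecR normc_distC.
Qed.

Lemma cvgC_le {T : Type} {F : set_system T} {FF : Filter F} (g : T -> R)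
    (f : T -> R[i]^o) (l : R[i]) :
  (\forall x \near F, normc (f x - l) <= g x) -> g x @[x --> F] --> (0 : R) ->
  f x @[x --> F] --> (l : R[i]^o).
Proof.
move=> fg g0; apply/cvgCP; apply: (squeeze_cvgr _ (cvg_cst 0) g0).
by near do rewrite normc_ge0 /=.
Unshelve. all: by end_near. Qed.

Lemma cvgC_real {T : Type} {F : set_system T} {FF : Filter F} (f : T -> R) (l : R) :
  f x @[x --> F] --> l -> ((f x)%:C : R[i]^o) @[x --> F] --> (l%:C : R[i]^o).
Proof.
move=> fl; apply/cvgCP; under eq_fun do rewrite -rmorphB normcR.
apply/norm_cvg0P; rewrite -(subrr l).
by apply: cvgB => //; exact: cvg_cst.
Qed.

Lemma normc_lim_le (u : nat -> R[i]^o) (l : R[i]) (b : R) :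
  (\forall n \near \oo, normc (u n) <= b) -> u @ \oo --> (l : R[i]^o) ->
  normc l <= b.
Proof.
move=> ub /cvgCP ul.
apply/ler_addgt0Pr => e e0.
have /cvgrPdist_le/(_ _ e0) ul' := ul.
near \oo => n.
have h1 : normc (u n) <= b by near: n.
have : `|0 - normc (u n - l)| <= e by near: n.
rewrite sub0r normrN ger0_norm ?normc_ge0// normc_distC => h2.
have := normcB_ge l (u n); lra.
Unshelve. all: by end_near. Qed.

Lemma le_ReIm z : `|complex.Re z| <= normc z /\ `|complex.Im z| <= normc z.
Proof.
rewrite /normc; case: z => a b /=; split; rewrite -sqrtr_sqr ler_wsqrtr//.
  by rewrite lerDl sqr_ge0.
by rewrite lerDr sqr_ge0.
Qed.

Lemma normc_le_ReIm z : normc z <= `|complex.Re z| + `|complex.Im z|.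
Proof.
rewrite [in X in X <= _](complexE z) (le_trans (normcD _ _))//.
by rewrite normcM normci mul1r !normcR.
Qed.

(** Real and imaginary parts are each dominated by the modulus, so the real comparison test applies
    to both. *)
Lemma is_cvgC_series (f : nat -> R[i]^o) (M : nat -> R) :
  (forall k, normc (f k) <= M k) -> cvgn (series M) -> cvgn (series f).
Proof.
move=> fM cM.
have c1 (p : R[i] -> R) : (forall z, `|p z| <= normc z) ->
    cvgn (series (p \o f)).
  move=> pz; apply: normed_cvg.
  apply: (@series_le_cvg _ (fun k => `|p (f k)|) M) => // k.
    exact: le_trans (normc_ge0 _) (fM k).
  exact: le_trans (pz _) (fM k).
have cr := c1 (@complex.Re R) (fun z => (le_ReIm z).1).
have ci := c1 (@complex.Im R) (fun z => (le_ReIm z).2).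
apply/cvg_ex; exists ((limn (series (@complex.Re R \o f)))%:C +
  'i%C * (limn (series (@complex.Im R \o f)))%:C).
apply: (@cvgC_le _ _ _ (fun n =>
  `|series (@complex.Re R \o f) n - limn (series (@complex.Re R \o f))| +
  `|series (@complex.Im R \o f) n - limn (series (@complex.Im R \o f))|)).
  apply: nearW => n; apply: le_trans (normc_le_ReIm _) _.
  have -> : \sum_(0 <= k < n) f k = (series (@complex.Re R \o f) n)%:C +
     'i%C * (series (@complex.Im R \o f) n)%:C :> R[i].
    rewrite /series /= !rmorph_sum /= mulr_sumr -big_split /=.
    by apply: eq_bigr => k _; exact: complexE.
  move: (limn _) (limn _) (series _ n) (series _ n) => a b c d.
  by simpc; rewrite /= ?(subr0,addr0,add0r,oppr0) lexx.
have cvg0 (u : R^nat) : cvgn u -> `|u n - limn u| @[n --> \oo] --> (0 : R).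
  move=> cu; rewrite -(normr0 R) -(subrr (limn u)).
  by apply: cvg_norm; apply: cvgB => //; exact: cvg_cst.
by rewrite -(addr0 (0 : R)); apply: cvgD; exact: cvg0.
Qed.

Lemma cvgCZ {T : Type} {F : set_system T} {FF : Filter F} (c : R[i])
    (f : T -> R[i]^o) (l : R[i]) :
  f x @[x --> F] --> (l : R[i]^o) ->
  (c * f x : R[i]^o) @[x --> F] --> (c * l : R[i]^o).
Proof. by move=> fl; apply: cvgM; [exact: cvg_cst|exact: fl]. Qed.

Lemma cvgCM {T : Type} {F : set_system T} {FF : Filter F}
    (f g : T -> R[i]^o) (k l : R[i]) :
  f x @[x --> F] --> (k : R[i]^o) -> g x @[x --> F] --> (l : R[i]^o) ->
  (f x * g x : R[i]^o) @[x --> F] --> (k * l : R[i]^o).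
Proof. by move=> fl gl; apply: cvgM; [exact: fl|exact: gl]. Qed.

Lemma cvgCB0 {T : Type} {F : set_system T} {FF : Filter F}
    (f g : T -> R[i]^o) (l : R[i]) :
  f x @[x --> F] --> (l : R[i]^o) -> g x @[x --> F] --> (l : R[i]^o) ->
  (f x - g x : R[i]^o) @[x --> F] --> (0 : R[i]^o).
Proof.
by move=> fl gl; rewrite -(subrr l); apply: cvgB; [exact: fl|exact: gl].
Qed.

Lemma cvgC_unique {T : Type} {F : set_system T} {FF : ProperFilter F}
    (f : T -> R[i]^o) (k l : R[i]) :
  f x @[x --> F] --> (k : R[i]^o) -> f x @[x --> F] --> (l : R[i]^o) -> k = l.
Proof. exact: (@cvg_unique _ (@norm_hausdorff _ R[i]^o)). Qed.

End ComplexLimits.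

(** * Dominated convergence for series *)

Section Tannery.
Variable R : realType.

Lemma is_cvg_series_inv_sqr : cvgn (series (fun k => (k.+1%:R ^+ 2)^-1 : R)).
Proof.
(* Telescoping: 1/(x+1)^2 <= 1/x - 1/(x+1). *)
have E n : \sum_(0 <= k < n.+1) (k.+1%:R ^+ 2)^-1 <= 2 - n.+1%:R^-1 :> R.
  elim: n => [|n IH].
    by rewrite big_nat1 expr1n invr1; lra.
  rewrite big_nat_recr//=; apply: le_trans (lerD IH (lexx _)) _.
  have h1 : (0 : R) < n.+1%:R by rewrite ltr0n.
  have e2 : (n.+2%:R : R) = n.+1%:R + 1 by rewrite -natr1.
  rewrite e2 -subr_ge0.
  set x := n.+1%:R in h1 *.
  have -> : 2 - (x + 1)^-1 - (2 - x^-1 + ((x + 1) ^+ 2)^-1) =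
    (x * (x + 1) ^+ 2)^-1.
    by field; rewrite !gt_eqF//; lra.
  by rewrite invr_ge0 mulr_ge0 ?sqr_ge0// ltW.
apply: nondecreasing_is_cvgn.
  move=> m n mn; rewrite -subr_ge0 sub_series_geq//.
  by apply: sumr_ge0 => k _; rewrite invr_ge0 sqr_ge0.
exists 2 => _ [n _ <-].
apply: (@le_trans _ _ (series (fun k => (k.+1%:R ^+ 2)^-1) n.+1)).
  by rewrite -subr_ge0 seriesSB invr_ge0 sqr_ge0.
by apply: le_trans (E n) _; rewrite gerBl invr_ge0.
Qed.

(** Domination is asked only for large N and k < N: the growth bound needs enough factors, and the
    k-th root is a root of the truncation of level M only for k < M. The bound on [g] is returned
    because the limit series is estimated again later. *)
Lemma tannery (f : nat -> nat -> R[i]) (g : nat -> R[i]) (M : nat -> R) :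
  cvgn (series M) ->
  (\forall N \near \oo, forall k, (k < N)%N -> normc (f N k) <= M k) ->
  (forall k, (f^~ k : nat -> R[i]^o) @ \oo --> (g k : R[i]^o)) ->
  (forall k, normc (g k) <= M k) /\
  ((fun N => \sum_(0 <= k < N) f N k) : nat -> R[i]^o) @ \oo -->
    limn (series (g : nat -> R[i]^o)).
Proof.
move=> cM fM fg.
have gM k : normc (g k) <= M k.
  apply: (@normc_lim_le _ _ _ _ _ (fg k)).
  near=> N; have H : forall k, (k < N)%N -> normc (f N k) <= M k by near: N.
  by apply: H; near: N; exact: nbhs_infty_gt.
split => //.
have cg : cvgn (series (g : nat -> R[i]^o)) by exact: is_cvgC_series gM cM.
suff d0 : ((fun N => \sum_(0 <= k < N) f N k - series (g : nat -> R[i]^o) N) :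
    nat -> R[i]^o) @ \oo --> (0 : R[i]^o).
  have -> : (fun N => \sum_(0 <= k < N) f N k) = (fun N =>
      (\sum_(0 <= k < N) f N k - series (g : nat -> R[i]^o) N) +
      series (g : nat -> R[i]^o) N) by apply/funext => N; rewrite subrK.
  by rewrite -[limn _]add0r; exact: cvgD d0 cg.
apply/cvgCP; apply/cvgrPdist_le => e e0.
(* Two partial sums within e/8 of the limit give a tail of at most e/4; it counts twice, for [f] and
   for [g], and the head takes the other e/2. *)
have e4 : 0 < e / 8 by lra.
have /cvgrPdist_le/(_ _ e4) := cM.
case=> K _ HK.
have tail N : (K <= N)%N -> \sum_(K <= k < N) M k <= e / 4.
  move=> KN; have h1 := HK K (leqnn K); have h2 := HK N KN.
  rewrite -sub_series_geq//.
  move: h1 h2; rewrite /= !ler_norml => /andP[? ?] /andP[? ?]; lra.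
have head : \forall N \near \oo, \sum_(0 <= k < K) normc (f N k - g k) <= e / 2.
  have : (fun N => \sum_(0 <= k < K) normc (f N k - g k)) @ \oo --> (0 : R).
    elim: (K) => [|k IH]; first by under eq_fun do rewrite big_nil; exact: cvg_cst.
    under eq_fun do rewrite big_nat_recr//=.
    by have /cvgCP h := fg k; have := cvgD IH h; rewrite addr0; apply.
  have e2 : 0 < e / 2 by lra.
  move=> /cvgrPdist_le/(_ _ e2); apply: filterS => N.
  by rewrite sub0r normrN; apply: le_trans; exact: ler_norm.
near=> N.
have KN : (K <= N)%N by near: N; exact: nbhs_infty_ge.
have H : forall k, (k < N)%N -> normc (f N k) <= M k by near: N.
have H2 : \sum_(0 <= k < K) normc (f N k - g k) <= e / 2 by near: N.
rewrite sub0r normrN ger0_norm ?normc_ge0// subr0 /series /= -sumrB.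
apply: le_trans (normc_sum _ _ _) _.
rewrite (big_cat_nat _ KN) //=.
have : \sum_(K <= k < N) normc (f N k - g k) <= \sum_(K <= k < N) (M k + M k).
  apply: ler_sum_nat => k /andP[_ kN]; apply: le_trans (normcD _ _) _.
  by rewrite normc_opp lerD// H.
rewrite big_split /=; have := tail N KN; lra.
Unshelve. all: by end_near. Qed.

End Tannery.

(** * Partial fractions *)

Section PartialFractions.
Variables (F : fieldType) (p : {poly F}) (M : nat) (r : nat -> F).
Hypothesis p_neq0 : p != 0.
Hypothesis size_p : (size p <= M.+1)%N.
Hypothesis r_inj : forall k l, (k < M)%N -> (l < M)%N -> r k = r l -> k = l.
Hypothesis p_root : forall k, (k < M)%N -> root p (r k).

Lemma poly_eq0_nodes (h : {poly F}) :
  (size h <= M)%N -> (forall k, (k < M)%N -> root h (r k)) -> h = 0.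
Proof.
move=> sh rh; apply: (@roots_geq_poly_eq0 _ _ (mkseq r M)).
- by apply/allP => x /mapP[k]; rewrite mem_iota => /rh ? ->.
- rewrite map_inj_in_uniq ?iota_uniq// => k l; rewrite !mem_iota => kM lM.
  exact: r_inj.
- by rewrite size_mkseq.
Qed.

(** The M distinct roots exhaust the degree: if p' vanished at r_k, the cofactor p / (X - r_k) would
    vanish at all M nodes. *)
Lemma deriv_root_neq0 k : (k < M)%N -> p^`().[r k] != 0.
Proof.
move=> kM; have /factor_theorem[s ps] := p_root kM.
have s0 : s != 0 by apply: contraNneq p_neq0 => s0; rewrite ps s0 mul0r.
have E : p^`().[r k] = s.[r k].
  by rewrite ps derivM derivXsubC !hornerE subrr mulr0 add0r.
apply: contraNneq (s0) => d0; apply/eqP; apply: poly_eq0_nodes.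
  move: size_p; rewrite ps size_Mmonic ?monicXsubC//.
  by rewrite size_XsubC addn2.
move=> l lM; have [->|lk] := eqVneq l k; first by rewrite /root -E d0.
have := p_root lM; rewrite ps rootM root_XsubC => /orP[//|/eqP h].
by move: lk; rewrite (r_inj lM kM h) eqxx.
Qed.

(** Lagrange interpolation of X^n: with s_k = p / (X - r_k), the quotients s_k / p'(r_k) are the
    basis polynomials at the nodes. Writing r_k - w as r_k (1 - w / r_k) prepares the geometric
    series in w and causes the minus sign. *)
Lemma partial_fractions n w : (n < M)%N -> (forall k, (k < M)%N -> r k != 0) ->
    (forall k, (k < M)%N -> w != r k) ->
  w ^+ n = - p.[w] *
    \sum_(0 <= k < M) r k ^+ n / (r k * p^`().[r k] * (1 - w / r k)).
Proof.
move=> nM r0 wr.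
pose s k := p %/ ('X - (r k)%:P).
have ps k : (k < M)%N -> p = s k * ('X - (r k)%:P).
  by move=> kM; rewrite divpK// dvdp_XsubCl p_root.
have sz k : (k < M)%N -> (size (s k) <= M)%N.
  move=> kM; have := size_p; rewrite {1}(ps k kM).
  rewrite size_Mmonic ?monicXsubC ?size_XsubC ?addn2 /= ?ltnS//.
  by apply: contraNneq p_neq0 => s0; rewrite (ps k kM) s0 mul0r.
have dE k : (k < M)%N -> p^`().[r k] = (s k).[r k].
  move=> kM; rewrite {1}(ps k kM) derivM derivXsubC.
  by rewrite !hornerE subrr mulr0 add0r.
pose h := 'X^n - \sum_(0 <= k < M) (r k ^+ n / p^`().[r k]) *: s k.
have h0 : h = 0.
  apply: poly_eq0_nodes.
    rewrite (leq_trans (size_polyD _ _))// geq_max size_polyXn nM size_polyN.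
    rewrite big_seq_cond; elim/big_rec: _ => [|k x]; first by rewrite size_poly0.
    rewrite mem_index_iota andbT => /andP[_ kM] xM.
    rewrite (leq_trans (size_polyD _ _))// geq_max; apply/andP; split => //.
    exact: leq_trans (size_scale_leq _ _) (sz _ kM).
  move=> l lM; rewrite /root !hornerE horner_sum subr_eq0; apply/eqP.
  rewrite (bigD1_seq l) ?iota_uniq ?mem_index_iota//= hornerZ -(dE l lM).
  rewrite divfK ?deriv_root_neq0// big_seq_cond big1 ?addr0// => k.
  rewrite mem_index_iota => /andP[/andP[_ kM] kl].
  have := p_root lM; rewrite {1}(ps k kM) rootM root_XsubC => /orP[/eqP e|/eqP e].
    by rewrite hornerZ e mulr0.
  by move: kl; rewrite (r_inj lM kM e) eqxx.
have : h.[w] = 0 by rewrite h0 horner0.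
rewrite !hornerE horner_sum => /eqP; rewrite subr_eq0 => /eqP ->.
rewrite mulr_sumr big_seq_cond [RHS]big_seq_cond; apply: eq_bigr => k.
rewrite mem_index_iota => /andP[/andP[_ kM] _].
rewrite hornerZ {2}(ps k kM) hornerM hornerXsubC.
have d0 := deriv_root_neq0 kM; have rk := r0 k kM.
have wk : w - r k != 0 by rewrite subr_eq0 wr.
by field; rewrite rk d0/= subr_eq0 eq_sym wr.
Qed.

End PartialFractions.

(** * Partial products *)

Section PartialProducts.
Variables (K : comNzRingType) (b : nat -> K).

Definition pprod N z : K := \prod_(0 <= j < N) (1 + b j * z).

(** The derivative of [pprod N] by the product rule; [pprod_taylor] ties it to difference
    quotients. *)
Fixpoint dpprod N z : K :=
  if N is n.+1 then dpprod n z * (1 + b n * z) + b n * pprod n z else 0.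

Lemma pprod0 z : pprod 0 z = 1. Proof. by rewrite /pprod big_nil. Qed.

Lemma pprodS N z : pprod N.+1 z = pprod N z * (1 + b N * z).
Proof. by rewrite /pprod big_nat_recr. Qed.

End PartialProducts.

(** * Bounds on the products uniform in the number of factors, and their limits *)

Section ComplexProducts.
Variables (R : realType) (a : nat -> R).
Hypothesis a_gt0 : forall j, 0 < a j.
Hypothesis a_sum : forall N, \sum_(0 <= j < N) a j <= 1.
Implicit Types (z h : R[i]) (r : R).

Local Notation aC := (fun j => (a j)%:C).
Local Notation P := (pprod aC).
Local Notation D := (dpprod aC).

Let a_ge0 j : 0 <= a j. Proof. exact: ltW. Qed.

Lemma pprodR_gt0 N r : 0 <= r -> 0 < pprod a N r.
Proof.
move=> r0; elim: N => [|N IH]; first by rewrite pprod0.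
by rewrite pprodS mulr_gt0// ltr_wpDr// mulr_ge0.
Qed.

Lemma dpprodR_ge0 N r : 0 <= r -> 0 <= dpprod a N r.
Proof.
move=> r0; elim: N => [|N IH] //=.
by rewrite addr_ge0// mulr_ge0// ?(ltW (pprodR_gt0 _ _))// addr_ge0// mulr_ge0.
Qed.

Lemma pprodR_le_expR N r : 0 <= r -> pprod a N r <= expR r.
Proof.
move=> r0; apply: (@le_trans _ _ (expR ((\sum_(0 <= j < N) a j) * r))); last first.
  by rewrite ler_expR ler_piMl.
elim: N => [|N IH]; first by rewrite pprod0 big_nil mul0r expR0.
rewrite pprodS big_nat_recr//= mulrDl expRD ler_pM// ?expR_ge1Dx//.
  exact: ltW (pprodR_gt0 _ _).
by rewrite addr_ge0// mulr_ge0.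
Qed.

Lemma normc_linear_le N z : normc (1 + (a N)%:C * z) <= 1 + a N * normc z.
Proof.
by rewrite (le_trans (normcD _ _))// normc1 normcM normcR ger0_norm.
Qed.

Lemma normc_pprod_le N z : normc (P N z) <= pprod a N (normc z).
Proof.
elim: N => [|N IH]; first by rewrite !pprod0 normc1.
by rewrite !pprodS normcM ler_pM ?normc_ge0// normc_linear_le.
Qed.

Lemma normc_dpprod_le N z : normc (D N z) <= dpprod a N (normc z).
Proof.
elim: N => [|N IH] /=; first by rewrite normc0.
rewrite (le_trans (normcD _ _))// !normcM normcR ger0_norm//.
by rewrite lerD// ler_pM ?normc_ge0 ?normc_linear_le// normc_pprod_le.
Qed.

Let rem N r := pprod a N (r + 1) - pprod a N r - dpprod a N r.

Let remS N r :
  rem N.+1 r = rem N r * (1 + a N * (r + 1)) + a N * dpprod a N r.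
Proof. by rewrite /rem !pprodS /=; ring. Qed.

Let rem_ge0 N r : 0 <= r -> 0 <= rem N r.
Proof.
move=> r0; elim: N => [|N IH]; first by rewrite /rem !pprod0 /= !subrr.
by rewrite remS addr_ge0// mulr_ge0 ?dpprodR_ge0// addr_ge0// mulr_ge0// addr_ge0.
Qed.

(** By convexity the derivative at r is at most the increment P(r + 1) - P(r). *)
Lemma dpprodR_le_expR N r : 0 <= r -> dpprod a N r <= expR (r + 1).
Proof.
move=> r0; have := rem_ge0 N r0; rewrite /rem.
have := pprodR_gt0 N r0; have : 0 <= r + 1 by lra.
by move=> /(pprodR_le_expR N); lra.
Qed.

Lemma normc_pprod_le_expR N z : normc (P N z) <= expR (normc z).
Proof.
apply: le_trans (normc_pprod_le _ _) _.
by rewrite pprodR_le_expR ?normc_ge0.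
Qed.

(* Induction on the number of factors; for real arguments and h = 1 the
   inductive bound is an equality, which is what makes it close up. *)
Lemma pprod_taylor N z h : normc h <= 1 ->
  normc (P N (z + h) - P N z - h * D N z) <=
    normc h ^+ 2 * expR (normc z + 1).
Proof.
move=> h1; set r := normc z; have r0 : 0 <= r by exact: normc_ge0.
apply: (@le_trans _ _ (normc h ^+ 2 * rem N r)); last first.
  rewrite ler_wpM2l ?sqr_ge0//; have := pprodR_gt0 N r0.
  have := dpprodR_ge0 N r0; have := @pprodR_le_expR N (r + 1); rewrite /rem; lra.
elim: N => [|N IH].
  by rewrite /rem !pprod0 /= mulr0 !subrr normc0 mulr0.
have -> : P N.+1 (z + h) - P N.+1 z - h * D N.+1 z =
   (P N (z + h) - P N z - h * D N z) * (1 + (a N)%:C * (z + h)) +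
   h ^+ 2 * ((a N)%:C * D N z) by rewrite !pprodS /=; ring.
rewrite remS [leRHS]mulrDr; apply: (le_trans (normcD _ _)); apply: lerD.
  rewrite normcM mulrA ler_pM ?normc_ge0// (le_trans (normc_linear_le _ _))//.
  by rewrite lerD2l ler_wpM2l// (le_trans (normcD _ _))// lerD2l.
rewrite normcM normcX ler_wpM2l ?sqr_ge0// normcM normcR ger0_norm//.
by rewrite ler_wpM2l// normc_dpprod_le.
Qed.

Lemma cvgn_of_summable_steps (u : nat -> R[i]^o) (c : R) : 0 <= c ->
  (forall n, normc (u n.+1 - u n) <= a n * c) -> cvgn u.
Proof.
move=> c0 uc.
have cM : cvgn (series (fun n => a n * c)).
  apply: nondecreasing_is_cvgn.
    move=> m n mn; rewrite -subr_ge0 sub_series_geq//.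
    by apply: sumr_ge0 => k _; rewrite mulr_ge0.
  exists c => _ [n _ <-].
  by rewrite /series /= -mulr_suml ler_piMl.
have ct := @is_cvgC_series R (telescope u) _ uc cM.
have uE : (fun n => u 0%N + series (telescope u) n) = u.
  by apply/funext => n; rewrite -eq_sum_telescope.
have h : (fun n => u 0%N + series (telescope u) n) @ \oo -->
  u 0%N + limn (series (telescope u)) by apply: cvgD; [exact: cvg_cst|exact: ct].
by rewrite uE in h; apply/cvg_ex; eexists; exact: h.
Qed.

Lemma is_cvg_pprod z : cvgn (fun N => P N z : R[i]^o).
Proof.
apply: (@cvgn_of_summable_steps _ (normc z * expR (normc z))) => [|N].
  by rewrite mulr_ge0 ?normc_ge0// expR_ge0.
have -> : P N.+1 z - P N z = (a N)%:C * (z * P N z) by rewrite pprodS; ring.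
rewrite !normcM normcR ger0_norm// ler_wpM2l// ler_wpM2l ?normc_ge0//.
exact: normc_pprod_le_expR.
Qed.

Lemma is_cvg_dpprod z : cvgn (fun N => D N z : R[i]^o).
Proof.
apply: (@cvgn_of_summable_steps _ (expR (normc z + 1) * normc z + expR (normc z))).
  by rewrite addr_ge0 ?mulr_ge0 ?normc_ge0 ?expR_ge0.
move=> N.
have -> : D N.+1 z - D N z = (a N)%:C * (D N z * z + P N z) by rewrite /=; ring.
rewrite normcM normcR ger0_norm// ler_wpM2l// (le_trans (normcD _ _))//.
rewrite lerD ?normc_pprod_le_expR// normcM ler_wpM2r ?normc_ge0//.
by rewrite (le_trans (normc_dpprod_le _ _))// dpprodR_le_expR// normc_ge0.
Qed.

Definition iprod z : R[i] := limn (fun N => P N z : R[i]^o).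
Definition diprod z : R[i] := limn (fun N => D N z : R[i]^o).

Lemma cvg_pprod z : (fun N => P N z : R[i]^o) @ \oo --> (iprod z : R[i]^o).
Proof. exact: is_cvg_pprod. Qed.

Lemma cvg_dpprod z : (fun N => D N z : R[i]^o) @ \oo --> (diprod z : R[i]^o).
Proof. exact: is_cvg_dpprod. Qed.

Lemma iprod_taylor z h : normc h <= 1 ->
  normc (iprod (z + h) - iprod z - h * diprod z) <=
    normc h ^+ 2 * expR (normc z + 1).
Proof.
move=> h1; apply: (@normc_lim_le R
    (fun N => P N (z + h) - P N z - h * D N z : R[i]^o)).
  by apply: nearW => N; exact: pprod_taylor.
apply: cvgB; first by apply: cvgB; exact: cvg_pprod.
by apply: cvgM; [exact: cvg_cst|exact: cvg_dpprod].
Qed.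

Lemma pprod_lipschitz N z h : normc h <= 1 ->
  normc (P N (z + h) - P N z) <= normc h * (2 * expR (normc z + 1)).
Proof.
move=> h1; have h0 := normc_ge0 h.
have -> : P N (z + h) - P N z = P N (z + h) - P N z - h * D N z + h * D N z.
  by ring.
rewrite (le_trans (normcD _ _))//.
have t := pprod_taylor N z h1.
have e0 := expR_ge0 (normc z + 1).
have : normc (h * D N z) <= normc h * expR (normc z + 1).
  rewrite normcM ler_wpM2l// (le_trans (normc_dpprod_le _ _))//.
  by rewrite dpprodR_le_expR// normc_ge0.
have : normc h ^+ 2 * expR (normc z + 1) <= normc h * expR (normc z + 1).
  by rewrite ler_wpM2r// expr2 ler_piMl.
by lra.
Qed.

(** Adding the Taylor expansions from z to z + h and back leaves h (D(z + h) - D(z)), so no second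
    derivative has to be estimated. *)
Lemma dpprod_lipschitz N z h : normc h <= 1 ->
  normc (D N (z + h) - D N z) <= normc h * (2 * expR (normc z + 2)).
Proof.
move=> h1; have h0 := normc_ge0 h.
have [->|hn0] := eqVneq h 0; first by rewrite addr0 subrr normc0 mul0r.
have hp : 0 < normc h.
  by rewrite lt_def h0 andbT; apply: contra_neq hn0; exact: eq0_normc.
have t1 := pprod_taylor N z h1.
have hN1 : normc (- h) <= 1 by rewrite normc_opp.
have := pprod_taylor N (z + h) hN1; rewrite normc_opp addrK => t2.
rewrite -(ler_pM2l hp) mulrA -expr2 -normcM.
have -> : h * (D N (z + h) - D N z) =
  (P N (z + h) - P N z - h * D N z) +
  (P N z - P N (z + h) - (- h) * D N (z + h)) by ring.
rewrite (le_trans (normcD _ _))//.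
have e1 : expR (normc z + 1) <= expR (normc z + 2) by rewrite ler_expR; lra.
have e2 : expR (normc (z + h) + 1) <= expR (normc z + 2).
  by rewrite ler_expR; have := normcD z h; lra.
have hh : 0 <= normc h ^+ 2 by rewrite sqr_ge0.
have := ler_wpM2l hh e1; have := ler_wpM2l hh e2; lra.
Qed.

(** The Lipschitz constant does not depend on N, so the argument may move with N, as the truncated
    roots do. *)
Lemma cvg_pprod_diag (u : nat -> R[i]) (v : R[i]) :
  (u : nat -> R[i]^o) @ \oo --> (v : R[i]^o) ->
  (fun N => P N (u N) : R[i]^o) @ \oo --> (iprod v : R[i]^o).
Proof.
move=> /cvgCP uv; rewrite -[iprod v]add0r.
have -> : (fun N => P N (u N)) = (fun N => (P N (u N) - P N v) + P N v : R[i]^o).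
  by apply/funext => N; rewrite subrK.
apply: cvgD; last exact: cvg_pprod.
apply: (@cvgC_le _ _ _ _ (fun N => normc (u N - v) * (2 * expR (normc v + 1)))).
  have /cvgrPdist_le/(_ _ ltr01) := uv; apply: filterS => N.
  rewrite sub0r normrN ger0_norm ?normc_ge0// subr0.
  by move=> /(pprod_lipschitz N v); rewrite [v + _]addrC subrK.
rewrite -[X in _ --> X](mul0r (2 * expR (normc v + 1))).
by apply: cvgM => //; exact: cvg_cst.
Qed.

Lemma cvg_dpprod_diag (u : nat -> R[i]) (v : R[i]) :
  (u : nat -> R[i]^o) @ \oo --> (v : R[i]^o) ->
  (fun N => D N (u N) : R[i]^o) @ \oo --> (diprod v : R[i]^o).
Proof.
move=> /cvgCP uv; rewrite -[diprod v]add0r.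
have -> : (fun N => D N (u N)) = (fun N => (D N (u N) - D N v) + D N v : R[i]^o).
  by apply/funext => N; rewrite subrK.
apply: cvgD; last exact: cvg_dpprod.
apply: (@cvgC_le _ _ _ _ (fun N => normc (u N - v) * (2 * expR (normc v + 2)))).
  have /cvgrPdist_le/(_ _ ltr01) := uv; apply: filterS => N.
  rewrite sub0r normrN ger0_norm ?normc_ge0// subr0.
  by move=> /(dpprod_lipschitz N v); rewrite [v + _]addrC subrK.
rewrite -[X in _ --> X](mul0r (2 * expR (normc v + 2))).
by apply: cvgM => //; exact: cvg_cst.
Qed.

End ComplexProducts.

(** * Odd and even parts of the partial products *)

Definition hornE :=
  (hornerD, hornerN, hornerM, hornerZ, hornerX, hornerC, horner0).

Section ParityParts.
Variables (R : realType) (a : nat -> R).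
Hypothesis a_gt0 : forall j, 0 < a j.
Hypothesis a_sum : forall N, \sum_(0 <= j < N) a j <= 1.
Implicit Types (z : R[i]) (w x : R).

Local Notation aC := (fun j => (a j)%:C).

(* [prod_(j < N) (1 + a j z) = A_N(- z^2) + z U_N(- z^2)]; the pair is (A_N, U_N). *)
Fixpoint parity_parts N : {poly R} * {poly R} :=
  if N is n.+1 then
    ((parity_parts n).1 - a n *: ('X * (parity_parts n).2),
     (parity_parts n).2 + a n *: (parity_parts n).1)
  else (1, 0).

Local Notation A N := (parity_parts N).1.
Local Notation U N := (parity_parts N).2.

(* The derivative of [x U_N(x^2)], as a polynomial in [x^2]. *)
Definition dodd N : {poly R} := U N + 2%:R *: ('X * (U N)^`()).

Lemma size_parity_parts N :
  (size (A N) <= N./2.+1)%N /\ (size (U N) <= uphalf N)%N.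
Proof.
elim: N => [|N [sA sU]]; first by rewrite /= size_poly1 size_poly0.
rewrite [A _.+1]/= [U _.+1]/=; split.
  rewrite (leq_trans (size_polyD _ _))// geq_max size_polyN; apply/andP; split.
    by rewrite (leq_trans sA)// ltnS half_leq.
  rewrite (leq_trans (size_scale_leq _ _))// (leq_trans (size_polyMleq _ _))//.
  by rewrite size_polyX /= ltnS.
rewrite (leq_trans (size_polyD _ _))// geq_max; apply/andP; split.
  by rewrite (leq_trans sU)// uphalf_half; case: (odd N).
by rewrite (leq_trans (size_scale_leq _ _)).
Qed.

(** At w = x^2 this is the squared modulus of the truncated product at ix. *)
Definition modsq N w : R := \prod_(0 <= j < N) (1 + a j ^+ 2 * w).

Lemma modsqS N w : modsq N.+1 w = modsq N w * (1 + a N ^+ 2 * w).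
Proof. by rewrite /modsq big_nat_recr. Qed.

Lemma modsq_ge1 N w : 0 <= w -> 1 <= modsq N w.
Proof.
move=> w0; elim: N => [|N IH]; first by rewrite /modsq big_nil.
by rewrite modsqS mulr_ege1// lerDl mulr_ge0// sqr_ge0.
Qed.

Lemma modsqE N w : modsq N w = (A N).[w] ^+ 2 + w * (U N).[w] ^+ 2.
Proof.
elim: N => [|N IH]; first by rewrite /modsq big_nil /= !hornE; ring.
by rewrite modsqS IH /= !hornE; ring.
Qed.

(** With C(x) = A_N(x^2) and S(x) = x U_N(x^2) this is S'C - C'S in the variable w = x^2. It equals
    modsq times the derivative of the phase, sum_j a_j / (1 + a_j^2 w). *)
Definition wronskian N : {poly R} :=
  dodd N * A N - 2%:R *: ('X * (A N)^`() * U N).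

Lemma wronskianS N w :
  (wronskian N.+1).[w] = (1 + a N ^+ 2 * w) * (wronskian N).[w] + a N * modsq N w.
Proof.
rewrite modsqE /wronskian /dodd /= !poly.derivE.
by rewrite !hornE; ring.
Qed.

(** All terms of sum_j a_j / (1 + a_j^2 w) are positive; only j = 0 is kept. *)
Lemma wronskian_ge N w : (0 < N)%N -> 0 <= w ->
  a 0%N * modsq N w <= (1 + a 0%N ^+ 2 * w) * (wronskian N).[w].
Proof.
move=> + w0; have a2 j : 0 <= 1 + a j ^+ 2 * w by rewrite addr_ge0// mulr_ge0// sqr_ge0.
elim: N => // -[_ _|N /(_ isT) IH _].
  rewrite wronskianS modsqS /modsq big_nil /wronskian /dodd /= !poly.derivE !hornE.
  by rewrite le_eqVlt; apply/orP; left; apply/eqP; ring.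
rewrite wronskianS modsqS.
have := ler_wpM2r (a2 N.+1) IH.
have : 0 <= (1 + a 0%N ^+ 2 * w) * (a N.+1 * modsq N.+1 w).
  by rewrite mulr_ge0 ?a2// mulr_ge0 ?(ltW (a_gt0 _))// (le_trans ler01 (modsq_ge1 _ w0)).
set s := 1 + a 0%N ^+ 2 * w; set t := 1 + a N.+1 ^+ 2 * w => h0 h1.
rewrite mulrA (le_trans h1)// [leRHS](_ : _ =
  s * (wronskian N.+1).[w] * t + s * (a N.+1 * modsq N.+1 w)) ?lerDl//.
by ring.
Qed.

(** Squaring the Wronskian bound turns A_N, whose sign varies from root to root, into modsq, and one
    factor modsq cancels. *)
Lemma dodd_root_ge N w : (0 < N)%N -> 0 <= w -> (U N).[w] = 0 ->
  a 0%N ^+ 2 * modsq N w <= (1 + a 0%N ^+ 2 * w) ^+ 2 * (dodd N).[w] ^+ 2.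
Proof.
move=> N0 w0 Uw.
have W : (wronskian N).[w] = (dodd N).[w] * (A N).[w].
  by rewrite /wronskian !hornE Uw; ring.
have Q : modsq N w = (A N).[w] ^+ 2 by rewrite modsqE Uw expr0n mulr0 addr0.
have Q0 : 0 < modsq N w by rewrite (lt_le_trans ltr01 (modsq_ge1 _ _)).
have h := wronskian_ge N0 w0; rewrite W in h.
have h0 : 0 <= a 0%N * modsq N w by rewrite mulr_ge0 ?ltW.
have h2 := ler_pM h0 h0 h h; rewrite -(ler_pM2r Q0).
have <- : (1 + a 0%N ^+ 2 * w) * ((dodd N).[w] * (A N).[w]) *
  ((1 + a 0%N ^+ 2 * w) * ((dodd N).[w] * (A N).[w])) =
  (1 + a 0%N ^+ 2 * w) ^+ 2 * (dodd N).[w] ^+ 2 * modsq N w by rewrite Q; ring.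
by apply: le_trans h2; rewrite le_eqVlt; apply/orP; left; apply/eqP; ring.
Qed.

Lemma modsq_ge J N w : (J <= N)%N -> 0 <= w -> modsq J w <= modsq N w.
Proof.
move=> /subnK <- w0; elim: (N - J)%N => [|n IH]; first by rewrite lexx.
rewrite addSn modsqS (le_trans IH)// ler_peMr//.
  exact: le_trans ler01 (modsq_ge1 _ w0).
by rewrite lerDl mulr_ge0// sqr_ge0.
Qed.

(** The summand 1 is dropped from the factors 1 to J. Factor 0 stays whole, to cancel one of the two
    such factors in [dodd_root_ge]. *)
Lemma modsq_ge_exp J w : 0 <= w ->
  (1 + a 0%N ^+ 2 * w) * ((\prod_(0 <= j < J) a j.+1 ^+ 2) * w ^+ J) <= modsq J.+1 w.
Proof.
move=> w0; elim: J => [|J IH].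
  by rewrite /modsq big_nat1 big_nil expr0 !mulr1.
have p0 : 0 <= \prod_(0 <= j < J) a j.+1 ^+ 2.
  by apply: prodr_ge0 => j _; rewrite sqr_ge0.
have t0 : 0 <= a J.+1 ^+ 2 * w by rewrite mulr_ge0// sqr_ge0.
have l0 : 0 <= (1 + a 0%N ^+ 2 * w) * ((\prod_(0 <= j < J) a j.+1 ^+ 2) * w ^+ J).
  by rewrite mulr_ge0 ?mulr_ge0 ?exprn_ge0// addr_ge0// mulr_ge0// sqr_ge0.
have t1 : a J.+1 ^+ 2 * w <= 1 + a J.+1 ^+ 2 * w by rewrite lerDr.
rewrite modsqS; apply: le_trans (ler_pM l0 t0 IH t1).
rewrite [\prod_(0 <= j < J.+1) _]big_nat_recr//= (exprS w J).
by rewrite le_eqVlt; apply/orP; left; apply/eqP; ring.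
Qed.

(* At a root of U_N the Wronskian is [dodd N * A_N] and [A_N ^ 2 = modsq N],
   so the derivative inherits the growth of modsq. *)
Lemma dodd_root_growth m : exists c : R, 0 < c /\
  forall N x, (m.+2 < N)%N -> 1 <= x -> (U N).[x ^+ 2] = 0 ->
    c * x ^+ m <= `|(dodd N).[x ^+ 2]|.
Proof.
(* Of the m + 2 powers of w obtained, one pays for s <= 2 w, whose 2 reappears in [c2]; the rest is
   at least w^m = (x^m)^2. *)
pose p := \prod_(0 <= j < m.+2) a j.+1 ^+ 2.
have p0 : 0 < p by apply: prodr_gt0 => j _; rewrite exprn_gt0.
have a01 : a 0%N <= 1 by have := a_sum 1; rewrite big_nat1.
pose c2 := a 0%N ^+ 2 * p / 2.
have c0 : 0 < c2 by rewrite /c2 divr_gt0// mulr_gt0// exprn_gt0.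
exists (Num.sqrt c2); split; first by rewrite sqrtr_gt0.
move=> N x mN x1 Ux.
have x0 : 0 <= x by lra.
have N0 : (0 < N)%N by apply: leq_trans mN.
set w := x ^+ 2 in Ux *.
have w1 : 1 <= w by rewrite /w exprn_ege1.
have w0 : 0 <= w by lra.
have h1 := dodd_root_ge N0 w0 Ux.
have h2 := modsq_ge_exp m.+2 w0; rewrite -/p in h2.
have h3 := modsq_ge mN w0.
set s := 1 + a 0%N ^+ 2 * w in h1 h2.
have a2 : a 0%N ^+ 2 <= 1 by apply: exprn_ile1 => //; exact: ltW.
have s0 : 0 < s by rewrite /s ltr_wpDr// mulr_ge0// sqr_ge0.
have s2 : s <= 2 * w by rewrite /s; have := ler_wpM2r w0 a2; lra.
have h4 : a 0%N ^+ 2 * (p * w ^+ m.+2) <= s * (dodd N).[w] ^+ 2.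
  rewrite -(ler_pM2l s0); apply: le_trans (_ : a 0%N ^+ 2 * modsq N w <= _).
    have := ler_wpM2l (sqr_ge0 (a 0%N)) (le_trans h2 h3).
    by apply: le_trans; rewrite le_eqVlt; apply/orP; left; apply/eqP; ring.
  by apply: le_trans h1 _; rewrite [s * (s * _)]mulrA -expr2.
have h5 : a 0%N ^+ 2 * (p * w ^+ m.+2) <= 2 * w * (dodd N).[w] ^+ 2.
  by apply: le_trans h4 _; rewrite ler_wpM2r// sqr_ge0.
have wp : 0 < w by lra.
have h6 : c2 * w ^+ m.+1 <= (dodd N).[w] ^+ 2.
  rewrite -(ler_pM2l wp) -(@ler_pM2l _ 2)// [2 * (w * (_ ^+ 2))]mulrA.
  apply: le_trans h5; rewrite le_eqVlt; apply/orP; left; apply/eqP.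
  by rewrite /c2 [w ^+ m.+2]exprS; field.
rewrite -ler_sqr ?nnegrE ?mulr_ge0 ?sqrtr_ge0 ?exprn_ge0//.
rewrite exprMn sqr_sqrtr ?(ltW c0)// real_normK ?num_real//.
apply: le_trans h6; rewrite ler_wpM2l ?(ltW c0)// -exprM mulnC exprM -/w.
by rewrite exprS ler_peMl ?exprn_ge0.
Qed.

Section Complex.
Local Notation toC := (map_poly (real_complex R)).

Lemma pprod_parity N z :
  pprod aC N z = (toC (A N)).[- z ^+ 2] + z * (toC (U N)).[- z ^+ 2].
Proof.
elim: N => [|N IH].
  by rewrite pprod0 /= rmorph1 rmorph0 !hornE mulr0 addr0.
rewrite pprodS IH /= rmorphB rmorphD /= !map_polyZ rmorphM /= map_polyX !hornE.
by ring.
Qed.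

Lemma dpprod_parity N z :
  dpprod aC N z = - (2%:R * z * (toC (A N)^`()).[- z ^+ 2]) + (toC (dodd N)).[- z ^+ 2].
Proof.
elim: N => [|N IH].
  rewrite /dodd /= !poly.derivE mulr0 scaler0 addr0 rmorph0.
  by rewrite !hornE mulr0 oppr0 addr0.
rewrite /= IH pprod_parity /dodd /= !poly.derivE.
rewrite mul1r.
do 2!rewrite ?(rmorphB, rmorphD) /= ?map_polyZ ?rmorphM /= ?map_polyX ?hornE.
by rewrite !rmorph1; ring.
Qed.

Lemma pprod_odd_part N z :
  pprod aC N z - pprod aC N (- z) = 2%:R * z * (toC (U N)).[- z ^+ 2].
Proof. by rewrite !pprod_parity sqrrN; ring. Qed.

Lemma dpprod_even_part N z :
  dpprod aC N z + dpprod aC N (- z) = 2%:R * (toC (dodd N)).[- z ^+ 2].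
Proof. by rewrite !dpprod_parity sqrrN; ring. Qed.

End Complex.
End ParityParts.

(** * The argument of the partial products on the imaginary axis *)

Section Phase.
Variable R : realType.

Lemma sin_atan (x : R) : sin (atan x) = x / Num.sqrt (1 + x ^+ 2).
Proof.
have c0 : cos (atan x) != 0.
  by apply/lt0r_neq0/cos_gt0_pihalf; rewrite atan_gtNpi2 atan_ltpi2.
by rewrite -cos_atan -[in X in X * _](atanK x) /tan divfK.
Qed.

Lemma atan_sub_le (x y : R) : x <= y -> atan y - atan x <= y - x.
Proof.
move=> xy.
have datan z : z \in `]x, y[ -> is_derive z 1 atan (1 + z ^+ 2)^-1.
  by move=> _; exact: is_derive1_atan.
have catan : {within `[x, y], continuous (@atan R)}.
  by apply: derivable_within_continuous => z _; exact: ex_derive.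
have [c _ ->] := MVT_segment xy datan catan.
rewrite ler_piMl ?subr_ge0// invf_le1 ?lerDl ?sqr_ge0//.
by rewrite ltr_wpDr// sqr_ge0.
Qed.

Lemma sin_eq0_nat (y : R) : 0 <= y -> sin y = 0 -> exists n : nat, y = n%:R * pi.
Proof.
move=> y0 sy; have p0 := pi_gt0 R.
have yp : 0 <= y / pi by rewrite divr_ge0// ltW.
have /andP[h1 h2] := Num.Theory.truncn_itv yp.
set n := Num.truncn (y / pi) in h1 h2; exists n.
rewrite ler_pdivlMr// in h1; rewrite ltr_pdivrMr// -natr1 mulrDl mul1r in h2.
have s0 : sin (y - n%:R * pi) = 0.
  have := alternatingn (@sinDpi R) n (y - n%:R * pi).
  rewrite mulr_natl subrK sy => /esym/eqP.
  by rewrite mulf_eq0 signr_eq0 /= => /eqP.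
have [//|yn] := eqVneq y (n%:R * pi).
have : 0 < sin (y - n%:R * pi).
  apply: sin_gt0_pi; rewrite subr_gt0 lt_def yn h1 /=; lra.
by rewrite s0 ltxx.
Qed.

Variable a : nat -> R.
Hypothesis a_gt0 : forall j, 0 < a j.
Hypothesis a_sum : forall N, \sum_(0 <= j < N) a j <= 1.
Implicit Types x y : R.

Definition phase N x : R := \sum_(0 <= j < N) atan (a j * x).

Lemma phaseS N x : phase N.+1 x = phase N x + atan (a N * x).
Proof. by rewrite /phase big_nat_recr. Qed.

(** The factor 1 + i a_j x has modulus sqrt (1 + (a_j x)^2) and argument atan (a_j x); the induction
    is the addition formula. *)
Lemma parity_polar N x :
  (parity_parts a N).1.[x ^+ 2] = Num.sqrt (modsq a N (x ^+ 2)) * cos (phase N x) /\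
  x * (parity_parts a N).2.[x ^+ 2] = Num.sqrt (modsq a N (x ^+ 2)) * sin (phase N x).
Proof.
have x2 : 0 <= x ^+ 2 by rewrite sqr_ge0.
elim: N => [|N [IHA IHU]].
  by rewrite /modsq /phase !big_nil /= !hornE sqrtr1 cos0 sin0 !mulr0 mulr1.
rewrite phaseS cosD sinD cos_atan sin_atan modsqS.
rewrite sqrtrM ?(le_trans ler01 (modsq_ge1 _ _ x2))// -exprMn.
have s0 : 0 < 1 + (a N * x) ^+ 2 by rewrite ltr_wpDr// sqr_ge0.
set s := Num.sqrt (1 + _).
have sp : s != 0 by rewrite /s gt_eqF// sqrtr_gt0.
rewrite /= !hornE; move: IHA IHU.
set u := (parity_parts a N).2.[_]; set v := (parity_parts a N).1.[_] => IHA IHU.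
split.
  have -> : v - a N * (x ^+ 2 * u) = v - a N * x * (x * u) by ring.
  by rewrite IHA IHU; field.
have -> : x * (u + a N * v) = x * u + a N * x * v by ring.
by rewrite IHU IHA; field.
Qed.

Lemma phase_le N x y : x <= y -> phase N x <= phase N y.
Proof. by move=> xy; apply: ler_sum => j _; rewrite le_atan// ler_wpM2l// ltW. Qed.

Lemma phase_sub_le N x y : x <= y -> phase N y - phase N x <= y - x.
Proof.
move=> xy; rewrite /phase -sumrB.
apply: le_trans (_ : \sum_(0 <= j < N) a j * (y - x) <= _).
  apply: ler_sum => j _; rewrite mulrBr atan_sub_le// ler_wpM2l// ltW//.
by rewrite -mulr_suml ler_piMl// subr_ge0.
Qed.

Lemma phase0 N : phase N 0 = 0.
Proof. by rewrite /phase big1// => j _; rewrite mulr0 atan0. Qed.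

Lemma phase_homo x : 0 <= x -> {homo phase^~ x : m n / (m <= n)%N >-> m <= n}.
Proof.
move=> x0 m n /subnK <-; elim: (n - m)%N => [|k IH]; first by rewrite lexx.
rewrite addSn phaseS (le_trans IH)// lerDl -(@atan0 R) le_atan// mulr_ge0// ltW//.
Qed.

(** The first factor alone gives an increase independent of N, so strict monotonicity survives the
    limit. *)
Lemma phase_lt N x y : (0 < N)%N -> 0 <= x -> x < y ->
  phase N x + (phase 1 y - phase 1 x) <= phase N y.
Proof.
move=> N0 x0 xy; elim: N N0 => // -[|N] IH _; first by rewrite subrKC.
rewrite [X in X + _ <= _]phaseS [leRHS]phaseS addrAC lerD// ?IH//.
by rewrite le_atan// ler_wpM2l// ltW.
Qed.

Lemma phase1_lt x y : x < y -> 0 < phase 1 y - phase 1 x.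
Proof. by move=> xy; rewrite /phase !big_nat1 subr_gt0 lt_atan// ltr_pM2l. Qed.

Lemma phase_continuous N : continuous (phase N).
Proof.
move=> x; elim: N => [|N IH].
  rewrite [phase 0](_ : _ = cst 0); first exact: cst_continuous.
  by apply/funext => y; rewrite /phase big_nil.
rewrite [phase N.+1](_ : _ = fun y => phase N y + atan (a N * y)); last first.
  by apply/funext => y; rewrite phaseS.
apply: cvgD => //; apply: continuous_comp; last exact: continuous_atan.
exact: mulrl_continuous.
Qed.

Lemma phase_cvgy N : phase N x @[x --> +oo] --> N%:R * (pi / 2).
Proof.
elim: N => [|N IH].
  under eq_fun do rewrite /phase big_nil.
  by rewrite mul0r; exact: cvg_cst.
under eq_fun do rewrite phaseS.
rewrite -natr1 mulrDl mul1r; apply: cvgD => //.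
apply: (cvg_comp _ _ _ (@cvgy_atan R)).
exact: gt0_cvgMry.
Qed.

Lemma phase_reaches N c : 0 <= c -> c < N%:R * (pi / 2) ->
  exists x, 0 <= x /\ phase N x = c.
Proof.
move=> c0 cN.
have [y [y0 cy]] : exists y, 0 <= y /\ c <= phase N y.
  have /cvgrPdist_lt/(_ (N%:R * (pi / 2) - c)) := @phase_cvgy N.
  rewrite subr_gt0 => /(_ cN) h.
  near (pinfty_nbhs R) => y; exists y; split; first by near: y; exact: nbhs_pinfty_ge.
  have : `|N%:R * (pi / 2) - phase N y| < N%:R * (pi / 2) - c by near: y.
  by rewrite ltr_norml => /andP[_]; lra.
have cont : {within `[0, y], continuous (phase N)}.
  by apply: continuous_subspaceT; exact: phase_continuous.
have [|x xy <-] := IVT y0 cont (v := c).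
  by rewrite phase0 ge_min c0 /= le_max cy orbT.
by exists x; split => //; move: xy; rewrite in_itv /= => /andP[].
Unshelve. all: by end_near. Qed.

Lemma is_cvg_phase x : 0 <= x -> cvgn (phase^~ x).
Proof.
move=> x0; apply: nondecreasing_is_cvgn; first exact: phase_homo.
exists x => _ [N _ <-]; have := phase_sub_le N x0.
by rewrite phase0 !subr0.
Qed.

Definition iphase x : R := limn (phase^~ x).

Lemma cvg_phase x : 0 <= x -> phase^~ x @ \oo --> iphase x.
Proof. exact: is_cvg_phase. Qed.

Lemma phase_le_iphase N x : 0 <= x -> phase N x <= iphase x.
Proof.
move=> x0; apply: nondecreasing_cvgn_le; [exact: phase_homo|exact: is_cvg_phase].
Qed.

Lemma iphase_le x : 0 <= x -> iphase x <= x.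
Proof.
move=> x0; apply: limr_le; first exact: is_cvg_phase.
by apply: nearW => N; have := phase_sub_le N x0; rewrite phase0 !subr0.
Qed.

Lemma iphase_lt x y : 0 <= x -> x < y -> iphase x < iphase y.
Proof.
move=> x0 xy; have y0 : 0 <= y by rewrite (le_trans x0)// ltW.
rewrite -subr_gt0 (lt_le_trans (phase1_lt xy))//.
suff : iphase x <= iphase y - (phase 1 y - phase 1 x) by lra.
apply: limr_le; first exact: is_cvg_phase.
near=> N; have N0 : (0 < N)%N by near: N; exact: nbhs_infty_gt.
by have := phase_lt N0 x0 xy; have := phase_le_iphase N y0; lra.
Unshelve. all: by end_near. Qed.

Lemma iphase_inj x y : 0 <= x -> 0 <= y -> iphase x = iphase y -> x = y.
Proof.
move=> x0 y0 e; case: (ltgtP x y) => // h.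
  by have := iphase_lt x0 h; rewrite e ltxx.
by have := iphase_lt y0 h; rewrite e ltxx.
Qed.

(* For k < M the positive roots of the odd part of the truncation at 2M+1
   factors; [maxn] makes the sequence in M total and still monotone. *)
Definition root_at M k : R :=
  xget 0 [set x | 0 <= x /\ phase (maxn M k.+1).*2.+1 x = k.+1%:R * pi].

Lemma root_atP M k : 0 <= root_at M k /\
  phase (maxn M k.+1).*2.+1 (root_at M k) = k.+1%:R * pi.
Proof.
rewrite /root_at; case: xgetP => [x -> //|noroot]; exfalso.
have p0 := pi_gt0 R.
have [||x [x0 xe]] := @phase_reaches (maxn M k.+1).*2.+1 (k.+1%:R * pi).
- by rewrite mulr_ge0// ltW.
(* With m the maximum, the supremum (2m+1) pi/2 of the phase exceeds m pi, hence the level (k+1)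
   pi. *)
- have : k.+1%:R <= (maxn M k.+1)%:R :> R by rewrite ler_nat leq_maxr.
  move/(ler_wpM2r (ltW p0)).
  set m := maxn M k.+1; have -> : m.*2.+1%:R = 2 * m%:R + 1 :> R.
    by rewrite -natr1 -mul2n natrM.
  lra.
exact: (noroot x).
Qed.

(** Additional factors raise the phase, so the level (k+1) pi is reached earlier. *)
Lemma root_at_homo k : {homo root_at^~ k : m n / (m <= n)%N >-> n <= m}.
Proof.
move=> m n mn; rewrite leNgt; apply/negP => lt.
have [m0 mE] := root_atP m k; have [n0 nE] := root_atP n k.
have := phase_lt (isT : 0 < (maxn n k.+1).*2.+1)%N m0 lt.
have := phase1_lt lt; rewrite nE -mE => h1 h2.
have : phase (maxn m k.+1).*2.+1 (root_at m k) <=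
       phase (maxn n k.+1).*2.+1 (root_at m k).
  by apply: phase_homo => //; rewrite ltnS leq_double; lia.
lra.
Qed.

Lemma is_cvg_root_at k : cvgn (root_at^~ k).
Proof.
apply: nonincreasing_is_cvgn; first exact: root_at_homo.
by exists 0 => _ [M _ <-]; have [] := root_atP M k.
Qed.

Definition iroot k : R := limn (root_at^~ k).

Lemma cvg_root_at k : root_at^~ k @ \oo --> iroot k.
Proof. exact: is_cvg_root_at. Qed.

Lemma iroot_le M k : iroot k <= root_at M k.
Proof.
by apply: nonincreasing_cvgn_ge; [exact: root_at_homo|exact: is_cvg_root_at].
Qed.

(** The phases are 1-Lipschitz for every N: at the limit root they differ from (k+1) pi by at most
    the distance to the truncated root. *)
Lemma iphase_iroot k : 0 <= iroot k /\ iphase (iroot k) = k.+1%:R * pi.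
Proof.
have i0 : 0 <= iroot k.
  apply: limr_ge; first exact: is_cvg_root_at.
  by apply: nearW => M; have [] := root_atP M k.
split => //.
pose N M := (maxn M k.+1).*2.+1.
have c1 : (fun M => phase (N M) (iroot k)) @ \oo --> iphase (iroot k).
  apply: (cvg_comp N (phase^~ (iroot k)) _ (cvg_phase i0)).
  apply/cvgnyPge => A; near=> M.
  have MA : (A <= M)%N by near: M; exact: nbhs_infty_ge.
  by rewrite /N; lia.
have c2 : (fun M => phase (N M) (iroot k)) @ \oo --> k.+1%:R * pi.
  apply: (squeeze_cvgr (f := fun M => k.+1%:R * pi - (root_at M k - iroot k))
                       (h := fun=> k.+1%:R * pi)).
  - apply: nearW => M; have [_ <-] := root_atP M k.
    rewrite phase_le ?iroot_le// andbT.
    by have := phase_sub_le (N M) (iroot_le M k); rewrite -/(N M); lra.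
  - rewrite -[X in _ --> X]subr0 -[X in _ --> _ - X](subrr (iroot k)).
    apply: cvgB; first exact: cvg_cst.
    by apply: cvgB; [exact: cvg_root_at|exact: cvg_cst].
  - exact: cvg_cst.
exact: cvg_unique c1 c2.
Unshelve. all: by end_near. Qed.

(** From (k+1) pi = theta(xi_k) <= xi_k. This linear growth is the source of the majorant
    1/(k+1)^2. *)
Lemma iroot_ge k : k.+1%:R <= iroot k.
Proof.
have [i0 e] := iphase_iroot k; have := iphase_le i0; rewrite e.
have := pi_ge2 R; have : (0 : R) <= k.+1%:R by rewrite ler0n.
by nra.
Qed.

Lemma iroot_mono : {mono iroot : m n / (m <= n)%N >-> m <= n}.
Proof.
apply: le_mono => m n mn.
have [m0 mE] := iphase_iroot m; have [n0 nE] := iphase_iroot n.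
rewrite ltNge; apply/negP; rewrite le_eqVlt => /orP[/eqP e|/(iphase_lt n0)].
  have : m.+1%:R * pi = n.+1%:R * pi :> R by rewrite -mE -nE e.
  by move/(mulIf (lt0r_neq0 (pi_gt0 R)))/eqP; rewrite eqr_nat => /eqP [] e'; lia.
by rewrite mE nE ltr_pM2r ?pi_gt0// ltr_nat; lia.
Qed.

Lemma sin_iphase_eq0 x : 0 < x -> (sin (iphase x) = 0) <-> (exists k, x = iroot k).
Proof.
move=> x0; split; last first.
  move=> [k ->]; have [_ ->] := iphase_iroot k.
  by have := alternatingn (@sinDpi R) k.+1 0; rewrite add0r mulr_natl sin0 mulr0.
have ix : 0 < iphase x.
  apply: le_lt_trans (iphase_lt (lexx _) x0).
  by have := phase_le_iphase 0 (lexx 0); rewrite phase0.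
move=> /(sin_eq0_nat (ltW ix))[[|k] e]; first by rewrite e mul0r ltxx in ix.
exists k; have [i0 iE] := iphase_iroot k.
by apply: iphase_inj => //; [exact: ltW|rewrite iE].
Qed.

End Phase.

(** * The odd part of the infinite product *)

Section OddPart.
Variables (R : realType) (a : nat -> R).
Hypothesis a_gt0 : forall j, 0 < a j.
Hypothesis a_sum : forall N, \sum_(0 <= j < N) a j <= 1.
Implicit Types (z w h : R[i]).

Local Notation toC := (map_poly (real_complex R)).
Local Notation U N := (parity_parts a N).2.

Definition isin z : R[i] :=
  (iprod a ('i%C * z) - iprod a (- ('i%C * z))) / (2%:R * 'i%C).
Definition disin z : R[i] :=
  (diprod a ('i%C * z) + diprod a (- ('i%C * z))) / 2%:R.

Lemma ci_neq0 : ('i%C : R[i]) != 0. Proof. exact: neq0Ci. Qed.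
Lemma ci_sqr z : - ('i%C * z) ^+ 2 = z ^+ 2.
Proof. by rewrite exprMn sqr_i mulN1r opprK. Qed.

Lemma isin_taylor z h : normc h <= 1 ->
  normc (isin (z + h) - isin z - h * disin z) <= normc h ^+ 2 * expR (normc z + 1).
Proof.
move=> h1; set t := normc h ^+ 2 * _.
have ni (x : R[i]) : normc ('i%C * x) = normc x.
  rewrite normcM -[RHS]mul1r; congr (_ * _). exact: normci.
have t1 : normc (iprod a ('i%C * z + 'i%C * h) - iprod a ('i%C * z) -
    ('i%C * h) * diprod a ('i%C * z)) <= t.
  by rewrite /t -(ni h) -(ni z) iprod_taylor// ni.
have t2 : normc (iprod a (- ('i%C * z) + - ('i%C * h)) - iprod a (- ('i%C * z)) -
    (- ('i%C * h)) * diprod a (- ('i%C * z))) <= t.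
  have e1 : normc h = normc (- ('i%C * h)) by rewrite normc_opp ni.
  have e2 : normc z = normc (- ('i%C * z)) by rewrite normc_opp ni.
  by rewrite /t e1 e2 iprod_taylor// -e1.
have -> : isin (z + h) - isin z - h * disin z =
  ((iprod a ('i%C * z + 'i%C * h) - iprod a ('i%C * z) -
    ('i%C * h) * diprod a ('i%C * z)) -
  (iprod a (- ('i%C * z) + - ('i%C * h)) - iprod a (- ('i%C * z)) -
    (- ('i%C * h)) * diprod a (- ('i%C * z)))) / (2%:R * 'i%C).
  rewrite /isin /disin mulrDr opprD.
  by field; exact: ci_neq0.
have n2 : normc (2%:R * 'i%C : R[i]) = 2 by rewrite mulrC ni normc_nat.
rewrite normcM normcV n2 ler_pdivrMr//.
by rewrite (le_trans (normcD _ _))// normc_opp; lra.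
Qed.

Lemma cvg_isin_diag (u : nat -> R[i]) (v : R[i]) :
  (u : nat -> R[i]^o) @ \oo --> (v : R[i]^o) ->
  (fun N => u N * (toC (U N)).[u N ^+ 2] : R[i]^o) @ \oo --> (isin v : R[i]^o).
Proof.
move=> uv.
have iu : (fun N => 'i%C * u N : R[i]^o) @ \oo --> ('i%C * v : R[i]^o).
  exact: cvgCZ uv.
have niu : (fun N => - ('i%C * u N) : R[i]^o) @ \oo --> (- ('i%C * v) : R[i]^o).
  exact: (cvgN iu).
have -> : (fun N => u N * (toC (U N)).[u N ^+ 2] : R[i]^o) = (fun N =>
  (pprod (fun j => (a j)%:C) N ('i%C * u N) -
   pprod (fun j => (a j)%:C) N (- ('i%C * u N))) * (2%:R * 'i%C)^-1 : R[i]^o).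
  apply/funext => N; rewrite pprod_odd_part ci_sqr.
  by field; exact: ci_neq0.
apply: cvgCM; last exact: cvg_cst.
by apply: cvgB; [exact: cvg_pprod_diag iu|exact: cvg_pprod_diag niu].
Qed.

Lemma cvg_disin_diag (u : nat -> R[i]) (v : R[i]) :
  (u : nat -> R[i]^o) @ \oo --> (v : R[i]^o) ->
  (fun N => (toC (dodd a N)).[u N ^+ 2] : R[i]^o) @ \oo --> (disin v : R[i]^o).
Proof.
move=> uv.
have iu : (fun N => 'i%C * u N : R[i]^o) @ \oo --> ('i%C * v : R[i]^o).
  exact: cvgCZ uv.
have niu : (fun N => - ('i%C * u N) : R[i]^o) @ \oo --> (- ('i%C * v) : R[i]^o).
  exact: (cvgN iu).
have -> : (fun N => (toC (dodd a N)).[u N ^+ 2] : R[i]^o) = (fun N =>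
  (dpprod (fun j => (a j)%:C) N ('i%C * u N) +
   dpprod (fun j => (a j)%:C) N (- ('i%C * u N))) * (2%:R)^-1 : R[i]^o).
  apply/funext => N; rewrite dpprod_even_part ci_sqr.
  by field.
apply: cvgCM; last exact: cvg_cst.
by apply: cvgD; [exact: cvg_dpprod_diag iu|exact: cvg_dpprod_diag niu].
Qed.

Lemma horner_toC (p : {poly R}) (x : R) : (toC p).[x%:C] = (p.[x])%:C.
Proof. exact: horner_map. Qed.

(** The moduli stay between 1 and e^x, so r_N sin(theta_N) tends to 0 exactly when sin(theta_N)
    does. *)
Lemma isin_real_eq0 (x : R) : 0 < x -> isin x%:C = 0 <-> exists k, x = iroot a k.
Proof.
move=> x0; have x0' := ltW x0; rewrite -sin_iphase_eq0//.
have cs : (fun N => sin (phase a N x)) @ \oo --> sin (iphase a x).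
  apply: (cvg_comp _ _ (cvg_phase a_gt0 a_sum x0')).
  exact: continuous_sin.
have E N : x%:C * (toC (U N)).[x%:C ^+ 2] =
    (Num.sqrt (modsq a N (x ^+ 2)) * sin (phase a N x))%:C.
  by rewrite -rmorphXn horner_toC -rmorphM (parity_polar a N x).2.
have ci : (fun N => (Num.sqrt (modsq a N (x ^+ 2)) * sin (phase a N x))%:C
    : R[i]^o) @ \oo --> (isin x%:C : R[i]^o).
  rewrite [X in X @ _](_ : _ = fun N => x%:C * (toC (U N)).[x%:C ^+ 2]).
    exact: (@cvg_isin_diag (fun=> x%:C) x%:C (cvg_cst _)).
  by apply/funext => N; rewrite E.
have r1 N : 1 <= Num.sqrt (modsq a N (x ^+ 2)).
  by rewrite -[leLHS]sqrtr1 ler_wsqrtr// modsq_ge1// sqr_ge0.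
have rK N : Num.sqrt (modsq a N (x ^+ 2)) <= expR x.
  apply: le_trans (pprodR_le_expR a_gt0 a_sum N x0').
  elim: N => [|N IH]; first by rewrite /modsq big_nil sqrtr1 pprod0.
  have m0 : 0 <= modsq a N (x ^+ 2).
    by rewrite (le_trans ler01)// modsq_ge1// sqr_ge0.
  rewrite modsqS pprodS sqrtrM// ler_pM ?sqrtr_ge0//.
  have ax : 0 <= a N * x by rewrite mulr_ge0// ltW.
  rewrite -[leRHS]ger0_norm ?addr_ge0// -sqrtr_sqr.
  by rewrite ler_wsqrtr// -exprMn sqrrD expr1n mul1r; lra.
split => s0.
  move: ci; rewrite s0 => /cvgCP ci.
  apply: (@cvg_unique R _ ((fun N => sin (phase a N x)) @ \oo)) => //.
  apply/norm_cvg0P; apply: (squeeze_cvgr _ (cvg_cst 0) ci).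
  apply: nearW => N; rewrite normr_ge0 /= subr0 normcR normrM.
  by rewrite ler_peMl// ger0_norm ?(le_trans ler01).
rewrite s0 in cs.
apply: (cvgC_unique ci); apply: (@cvgC_le _ _ _ _ (fun N => expR x * `|sin (phase a N x)|)).
  apply: nearW => N; rewrite subr0 normcR normrM ler_wpM2r//.
  by rewrite ger0_norm// sqrtr_ge0.
rewrite -(mulr0 (expR x)); apply: cvgM; first exact: cvg_cst.
by apply/norm_cvg0P.
Qed.

Lemma cvg_halfn : (fun N : nat => N./2) @ \oo --> \oo.
Proof.
apply/cvgnyPge => A; near=> N.
have : (A.*2 <= N)%N by near: N; exact: nbhs_infty_ge.
by move=> /half_leq; rewrite doubleK.
Unshelve. all: by end_near. Qed.

Lemma cvg_doubleS : (fun M : nat => M.*2.+1) @ \oo --> \oo.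
Proof.
apply/cvgnyPge => A; near=> N.
have : (A <= N)%N by near: N; exact: nbhs_infty_ge.
lia.
Unshelve. all: by end_near. Qed.

(** * Partial fractions of the truncations and their majorant *)

Local Notation root_at := (root_at a).
Local Notation xi := (iroot a).

Lemma root_at_ge1 M k : k.+1%:R <= root_at M k.
Proof. exact: le_trans (iroot_ge a_gt0 a_sum k) (iroot_le a_gt0 M k). Qed.

(** Roots are indexed by M, the diagonal limit by the number N of factors: the roots are read at
    N./2 and the limit is then restricted to N = 2M+1. *)
Lemma cvg_dodd_root k :
  (fun M => ((dodd a M.*2.+1).[root_at M k ^+ 2])%:C : R[i]^o) @ \oo -->
  (disin (xi k)%:C : R[i]^o).
Proof.
have h1 : (fun N => (root_at N./2 k)%:C : R[i]^o) @ \oo --> ((xi k)%:C : R[i]^o).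
  apply: cvgC_real.
  exact: (cvg_comp _ _ cvg_halfn (cvg_root_at a_gt0 (k := k))).
have := cvg_comp _ _ cvg_doubleS (cvg_disin_diag h1).
apply: cvg_trans; apply: near_eq_cvg; apply: nearW => M /=.
by rewrite uphalf_double -rmorphXn horner_toC.
Qed.

Lemma odd_part_root M k : (k < M)%N -> (U M.*2.+1).[root_at M k ^+ 2] = 0.
Proof.
move=> kM; have [_ E] := root_atP a_gt0 M k.
rewrite (maxn_idPl _) in E; last by rewrite kM.
have x1 := root_at_ge1 M k.
have x0 : root_at M k != 0.
  by rewrite gt_eqF// (lt_le_trans _ x1)// ltr0n.
apply: (mulfI x0); rewrite (parity_polar a _ _).2 E mulr0.
have := alternatingn (@sinDpi R) k.+1 0; rewrite add0r mulr_natl sin0 mulr0.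
by move=> ->; rewrite mulr0.
Qed.

Lemma horner_dodd N x : (dodd a N).[x] = (U N).[x] + 2 * (x * (U N)^`().[x]).
Proof. by rewrite /dodd !hornE. Qed.

Lemma odd_part_neq0 N : (0 < N)%N -> 0 < (U N).[0].
Proof.
have E n : (parity_parts a n).1.[0] = 1 /\ (U n).[0] = \sum_(0 <= j < n) a j.
  elim: n => [|n [IH1 IH2]]; first by rewrite /= big_nil !hornE.
  by rewrite big_nat_recr//= !hornE IH1 IH2 mul0r mulr0 mulr1 subr0.
case: N => // N _; rewrite (E _).2 big_nat_recr//=.
by rewrite ltr_wpDl// sumr_ge0// => j _; rewrite ltW.
Qed.

(* The partial fraction term of [w^n / U] at the k-th root, with
   [2 w U'(w) = dodd] at the roots. *)
Definition trunc_term n w M k : R[i] :=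
  2%:R * (root_at M k ^+ 2)%:C ^+ n /
  (((dodd a M.*2.+1).[root_at M k ^+ 2])%:C * (1 - w / (root_at M k ^+ 2)%:C)).

Definition limit_term n w k : R[i] :=
  2%:R * (xi k ^+ 2)%:C ^+ n / (disin (xi k)%:C * (1 - w / (xi k ^+ 2)%:C)).

Lemma trunc_partial_fractions n w M : (n < M)%N -> normc w <= 1 / 2 ->
  w ^+ n = - (toC (U M.*2.+1)).[w] * \sum_(0 <= k < M) trunc_term n w M k.
Proof.
move=> nM w2; pose N := M.*2.+1.
have U0 : U N != 0.
  by apply/eqP => e; have := @odd_part_neq0 N isT; rewrite e horner0 ltxx.
have rho k : 1 <= root_at M k.
  by apply: le_trans (root_at_ge1 M k); rewrite ler1n.
have rho2 k : 1 <= root_at M k ^+ 2 by rewrite exprn_ege1.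
have r0 k : (root_at M k ^+ 2)%:C != 0 :> R[i].
  by rewrite fmorph_eq0 gt_eqF// (lt_le_trans _ (rho2 k)).
have rt k : (k < M)%N -> root (toC (U N)) (root_at M k ^+ 2)%:C.
  by move=> kM; rewrite /root horner_toC odd_part_root.
have inj k l : (k < M)%N -> (l < M)%N ->
    (root_at M k ^+ 2)%:C = (root_at M l ^+ 2)%:C :> R[i] -> k = l.
  move=> kM lM /complexI/eqP; rewrite eqrXn2 ?(le_trans ler01)// => /eqP e.
  have [_] := root_atP a_gt0 M k; have [_] := root_atP a_gt0 M l.
  rewrite !(maxn_idPl _)// e => -> /(mulIf (lt0r_neq0 (pi_gt0 R)))/eqP.
  by rewrite eqr_nat => /eqP [].
rewrite (@partial_fractions _ (toC (U N)) M (fun k => (root_at M k ^+ 2)%:C) _ _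
   inj rt n w nM) ?map_poly_eq0//; last 2 first.
- rewrite size_map_poly; have [_] := size_parity_parts a N.
  by move=> h; apply: (leq_trans h); rewrite /N uphalfE -doubleS doubleK.
- move=> k kM; apply/eqP => e; move: w2; rewrite e normcR ger0_norm ?sqr_ge0//.
  by have := rho2 k; lra.
congr (_ * _); apply: eq_big_nat => k /andP[_ kM]; rewrite /trunc_term.
have -> : (dodd a M.*2.+1).[root_at M k ^+ 2] =
    2 * (root_at M k ^+ 2 * (U N)^`().[root_at M k ^+ 2]).
  by rewrite horner_dodd odd_part_root// add0r.
rewrite deriv_map horner_toC; set v := root_at M k ^+ 2.
set p := (_)^`().[_]; set e := 1 - _.
have -> : (2 * (v * p))%:C = 2%:R * (v%:C * p%:C) :> R[i].
  by rewrite rmorphM rmorphM (rmorph_nat (real_complex R) 2).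
rewrite [(2%:R * (_ * _) * e)^-1]invfM [(2%:R * _)^-1]invfM invfM.
by move: (_ * p%:C)^-1 e^-1 => f g; field.
Qed.

Lemma normc_div_sqr_le w (x : R) : normc w <= 1 / 2 -> 1 <= x ->
  normc (w / (x ^+ 2)%:C) <= 1 / 2.
Proof.
move=> w2 x1; have x2 : 1 <= x ^+ 2 by rewrite exprn_ege1.
rewrite normcM normcV normcR ger0_norm ?sqr_ge0//; apply: le_trans w2.
by rewrite ler_pdivrMr ?(lt_le_trans ltr01 x2)// ler_peMr ?normc_ge0.
Qed.

Lemma trunc_term_le n w : normc w <= 1 / 2 -> exists c : R, 0 < c /\
  forall M k, (2 * n + 2 < M)%N -> (k < M)%N ->
    normc (trunc_term n w M k) <= c * (k.+1%:R ^+ 2)^-1.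
Proof.
(* The power 2n absorbs rho_k^(2n), and the other two give rho_k^-2 <= (k+1)^-2. In 4 / c one 2 is
   the numerator, the other comes from |1 - w / rho_k^2| >= 1/2. *)
move=> w2; have [c [c0 H]] := dodd_root_growth a_gt0 a_sum (2 * n + 2).
exists (4 / c); split; first by rewrite divr_gt0.
move=> M k nM kM; set x := root_at M k.
have xk : k.+1%:R <= x by exact: root_at_ge1.
have k1 : (1 : R) <= k.+1%:R by rewrite ler1n.
have x1 : 1 <= x by lra.
have xp : 0 < x by lra.
have mN : ((2 * n + 2).+2 < M.*2.+1)%N by lia.
have h := H _ x mN x1 (odd_part_root kM).
rewrite /trunc_term -/x; set d := (dodd a _).[_] in h *.
have x2 : 1 <= x ^+ 2 by rewrite exprn_ege1.
have e1 : 1 / 2 <= normc (1 - w / (x ^+ 2)%:C).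
  have := normcB_ge 1 (w / (x ^+ 2)%:C); rewrite normc1.
  by have := normc_div_sqr_le w2 x1; lra.
set e := 1 - _ in e1 *.
rewrite !normcM normcV normcM normc_nat normcX !normcR [`|x ^+ 2|]ger0_norm ?sqr_ge0//.
have dp : 0 < `|d| by apply: lt_le_trans h; rewrite mulr_gt0// exprn_gt0.
have ep : 0 < normc e by lra.
rewrite ler_pdivrMr ?mulr_gt0//.
have s1 : c * x ^+ (2 * n + 2) * (1 / 2) <= `|d| * normc e.
  by apply: ler_pM => //; rewrite ?mulr_ge0 ?exprn_ge0 ?ltW//; lra.
have kk : (0 : R) < k.+1%:R ^+ 2 by rewrite exprn_gt0// ltr0n.
apply: le_trans (ler_wpM2l _ s1); last first.
  by rewrite mulr_ge0 ?invr_ge0 ?ltW// divr_gt0.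
rewrite exprD [x ^+ (2 * n)]exprM.
have -> : 4 / c * (k.+1%:R ^+ 2)^-1 * (c * ((x ^+ 2) ^+ n * x ^+ 2) * (1 / 2)) =
  2 * (x ^+ 2) ^+ n * (x ^+ 2 / k.+1%:R ^+ 2) by field; lra.
apply: ler_peMr; first by rewrite mulr_ge0// exprn_ge0// sqr_ge0.
by rewrite ler_pdivlMr// mul1r ler_sqr ?nnegrE//; lra.
Qed.

(** For m = 0 the growth bound is a positive constant, which persists in the limit: the zeros are
    simple. *)
Lemma disin_root_neq0 k : disin (xi k)%:C != 0.
Proof.
have [c [c0 H]] := dodd_root_growth a_gt0 a_sum 0.
have /cvgCP h := @cvg_dodd_root k.
apply/eqP => e; move: h; rewrite e => /cvgrPdist_lt/(_ _ c0) h.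
near \oo => M.
have kM : (k < M)%N by near: M; exact: nbhs_infty_gt.
have M2 : (2 < M)%N by near: M; exact: nbhs_infty_gt.
have x1 : 1 <= root_at M k by apply: le_trans (root_at_ge1 M k); rewrite ler1n.
have mN : (2 < M.*2.+1)%N by lia.
have h2 := H _ _ mN x1 (odd_part_root kM).
have : `|0 - normc (((dodd a M.*2.+1).[root_at M k ^+ 2])%:C - 0)| < c by near: M.
rewrite sub0r normrN subr0 normcR normr_id.
by move: h2; rewrite expr0 mulr1; lra.
Unshelve. all: by end_near. Qed.

Lemma iroot_ge1 k : 1 <= xi k.
Proof. by apply: le_trans (iroot_ge a_gt0 a_sum k); rewrite ler1n. Qed.

Lemma one_sub_neq0 w (x : R) : normc w <= 1 / 2 -> 1 <= x -> 1 - w / (x ^+ 2)%:C != 0.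
Proof.
move=> w2 x1; have x2 : 1 <= x ^+ 2 by rewrite exprn_ege1.
rewrite subr_eq0; apply/eqP => e.
have := normc_div_sqr_le w2 x1; rewrite -e normc1; lra.
Qed.

End OddPart.

(** * Expansion of its reciprocal *)

Section Expansion.
Variables (R : realType) (a : nat -> R).
Hypothesis a_gt0 : forall j, 0 < a j.
Hypothesis a_sum : forall N, \sum_(0 <= j < N) a j <= 1.
Implicit Types (z w h : R[i]).

Local Notation toC := (map_poly (real_complex R)).
Local Notation U N := (parity_parts a N).2.
Local Notation xi := (iroot a).

Lemma near_eqC_cvg (f g : nat -> R[i]^o) (l : R[i]) :
  (\forall n \near \oo, f n = g n) ->
  f @ \oo --> (l : R[i]^o) -> g @ \oo --> (l : R[i]^o).
Proof. by move=> fg fl; apply: cvg_trans fl; apply: near_eq_cvg. Qed.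

Lemma cvgCX {T : Type} {F : set_system T} {FF : Filter F} n
    (f : T -> R[i]^o) (l : R[i]) :
  f x @[x --> F] --> (l : R[i]^o) ->
  (f x ^+ n : R[i]^o) @[x --> F] --> (l ^+ n : R[i]^o).
Proof.
move=> fl; elim: n => [|n IH]; first exact: cvg_cst.
rewrite exprS; under eq_fun do rewrite exprS.
exact: cvgCM fl IH.
Qed.

Lemma cvgCV {T : Type} {F : set_system T} {FF : Filter F}
    (f : T -> R[i]^o) (l : R[i]) : l != 0 ->
  f x @[x --> F] --> (l : R[i]^o) ->
  ((f x)^-1 : R[i]^o) @[x --> F] --> (l^-1 : R[i]^o).
Proof. by move=> l0 fl; apply: (cvgV l0); exact: fl. Qed.

Lemma xi_neq0 k : (xi k ^+ 2)%:C != 0 :> R[i].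
Proof.
rewrite fmorph_eq0 gt_eqF// exprn_gt0// (lt_le_trans ltr01)//.
exact: iroot_ge1.
Qed.

Lemma cvg_trunc_term n w k : normc w <= 1 / 2 ->
  (fun M => trunc_term a n w M k : R[i]^o) @ \oo --> (limit_term a n w k : R[i]^o).
Proof.
move=> w2.
have cx : (fun M => (root_at a M k ^+ 2)%:C : R[i]^o) @ \oo -->
    ((xi k ^+ 2)%:C : R[i]^o).
  apply: cvgC_real; rewrite expr2; under eq_fun do rewrite expr2.
  by apply: cvgM; exact: (cvg_root_at a_gt0 (k := k)).
apply: cvgCM; first exact: (cvgCZ (c := 2%:R) (cvgCX (n := n) cx)).
apply: cvgCV; first by rewrite mulf_neq0 ?disin_root_neq0 ?one_sub_neq0 ?iroot_ge1.
apply: cvgCM; first exact: (cvg_dodd_root a_gt0 a_sum (k := k)).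
apply: cvgB; first exact: cvg_cst.
exact: (cvgCZ (c := w) (cvgCV (xi_neq0 k) cx)).
Qed.

Lemma is_cvg_inv_sqr_bound (c : R) : cvgn (series (fun k => c * (k.+1%:R ^+ 2)^-1)).
Proof. exact: (is_cvg_seriesZ (k := c) (@is_cvg_series_inv_sqr R)). Qed.

Lemma sum_trunc_term n w : normc w <= 1 / 2 -> exists c : R,
  (forall k, normc (limit_term a n w k) <= c * (k.+1%:R ^+ 2)^-1) /\
  (fun M => \sum_(0 <= k < M) trunc_term a n w M k : R[i]^o) @ \oo -->
    limn (series (limit_term a n w : nat -> R[i]^o)).
Proof.
move=> w2; have [c [c0 H]] := trunc_term_le a_gt0 a_sum n w2; exists c.
apply: (tannery (is_cvg_inv_sqr_bound (c := c))).
  near=> M => k kM; apply: H => //; near: M; exact: nbhs_infty_gt.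
by move=> k; exact: cvg_trunc_term.
Unshelve. all: by end_near. Qed.

Lemma isin_partial_fractions n z : z != 0 -> normc (z ^+ 2) <= 1 / 2 ->
  z * (z ^+ 2) ^+ n =
    - isin a z * limn (series (limit_term a n (z ^+ 2) : nat -> R[i]^o)).
Proof.
move=> z0 z2; have [c [_ H]] := sum_trunc_term n z2.
have h0 : (fun N => z * (toC (U N)).[z ^+ 2] : R[i]^o) @ \oo --> (isin a z : R[i]^o).
  exact: (@cvg_isin_diag R a a_gt0 a_sum (fun=> z) z (cvg_cst _)).
have h : (fun M => z * (toC (U M.*2.+1)).[z ^+ 2] : R[i]^o) @ \oo -->
  (isin a z : R[i]^o) := cvg_comp _ _ cvg_doubleS h0.
have h2 := cvgCM (cvgCZ (c := -1) h) H; rewrite mulN1r in h2.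
apply: (@cvgC_unique R _ \oo _ (fun=> z * (z ^+ 2) ^+ n : R[i]^o)).
  exact: cvg_cst.
apply: near_eqC_cvg (h2 _ _); near=> M.
have nM : (n < M)%N by near: M; exact: nbhs_infty_gt.
by rewrite (trunc_partial_fractions a_gt0 a_sum nM z2) mulN1r mulrA mulrN.
Unshelve. all: by end_near. Qed.

(** Since U_N(0) > 0, the truncated sums vanish exactly as soon as M > n. *)
Lemma sum_limit_term0 n : (0 < n)%N ->
  limn (series (limit_term a n 0 : nat -> R[i]^o)) = 0.
Proof.
move=> n0; have w2 : normc (0 : R[i]) <= 1 / 2 by rewrite normc0.
have [c [_ H]] := sum_trunc_term n w2.
apply: (cvgC_unique H); apply: (@cvg_near_cst _ _ (0 : R[i]^o)).
near=> M.
have nM : (n < M)%N by near: M; exact: nbhs_infty_gt.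
have := trunc_partial_fractions a_gt0 a_sum nM w2.
rewrite expr0n eqn0Ngt n0 /= => /esym/eqP; rewrite mulf_eq0 oppr_eq0.
rewrite -(rmorph0 (real_complex R)) horner_toC fmorph_eq0.
have U0 := odd_part_neq0 a_gt0 (isT : 0 < M.*2.+1)%N.
by rewrite (gt_eqF U0) orFb => /eqP.
Unshelve. all: by end_near. Qed.

(** Summed over k, the value at w = 0 is -2 eta_q(2m), the m-th coefficient of the geometric
    expansion; for general w it is the remainder after m terms, divided by w^m. *)
Definition neg_term m w k : R[i] :=
  2%:R / ((xi k ^+ 2)%:C ^+ m * (disin a (xi k)%:C * (1 - w / (xi k ^+ 2)%:C))).

Lemma neg_term_le w : normc w <= 1 / 2 -> exists c : R, 
  forall m k, normc (neg_term m w k) <= c * (k.+1%:R ^+ 2)^-1.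
Proof.
move=> w2; have [c [H _]] := sum_trunc_term 0 w2; exists c => m k.
apply: le_trans (H k); rewrite /limit_term expr0 mulr1 /neg_term invfM mulrCA normcM.
rewrite ler_piMl ?normc_ge0// normcV normcX normcR invf_le1.
  by rewrite exprn_ege1// ger0_norm ?sqr_ge0// exprn_ege1// iroot_ge1.
by rewrite exprn_gt0// normr_gt0 -(fmorph_eq0 (real_complex R)) xi_neq0.
Qed.

Definition neg_sum m w : R[i] := limn (series (neg_term m w : nat -> R[i]^o)).

Lemma cvg_neg_sum m w : normc w <= 1 / 2 ->
  series (neg_term m w : nat -> R[i]^o) @ \oo --> (neg_sum m w : R[i]^o).
Proof.
move=> w2; have [c H] := neg_term_le w2.
exact: (is_cvgC_series (H m) (is_cvg_inv_sqr_bound (c := c))).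
Qed.

Lemma normc0_le_half : normc (0 : R[i]) <= 1 / 2. Proof. by rewrite normc0. Qed.

(** Termwise this is 1/(1 - u) = 1 + u/(1 - u) with u = w / xi_k^2. *)
Lemma neg_sumS m w : normc w <= 1 / 2 ->
  neg_sum m w = neg_sum m 0 + w * neg_sum m.+1 w.
Proof.
move=> w2; apply: (cvgC_unique (cvg_neg_sum (m := m) w2)).
have hZ : (fun n => w * series (neg_term m.+1 w : nat -> R[i]^o) n : R[i]^o) @ \oo -->
    (w * neg_sum m.+1 w : R[i]^o) := cvgCZ (cvg_neg_sum (m := m.+1) w2).
have hD : (fun n => series (neg_term m 0 : nat -> R[i]^o) n +
    w * series (neg_term m.+1 w : nat -> R[i]^o) n : R[i]^o) @ \oo -->
    (neg_sum m 0 + w * neg_sum m.+1 w : R[i]^o).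
  apply: cvgD; [|exact: hZ]. exact: (cvg_neg_sum (m := m) normc0_le_half).
apply: near_eqC_cvg hD; apply: nearW => M.
rewrite /series /= mulr_sumr -big_split; apply: eq_bigr => k _ /=.
have x0 := xi_neq0 k; have d0 := disin_root_neq0 a_gt0 a_sum k.
have w0 := one_sub_neq0 w2 (iroot_ge1 a_gt0 a_sum k).
have w1 : (xi k ^+ 2)%:C - w != 0.
  by apply: contraNneq w0 => e; rewrite -(divff x0) -mulrBl e mul0r.
rewrite /neg_term mul0r subr0 mulr1.
move: x0 d0 w1; move: (xi k ^+ 2)%:C (disin _ _) => x d x0 d0 w1.
rewrite exprS; have y0 := expf_neq0 m x0; move: (x ^+ m) y0 => y y0.
by field; rewrite x0 d0 w1 y0.
Qed.

Lemma neg_sum_expand w m : normc w <= 1 / 2 ->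
  neg_sum 0 w = \sum_(0 <= j < m) neg_sum j 0 * w ^+ j + w ^+ m * neg_sum m w.
Proof.
move=> w2; elim: m => [|m IH]; first by rewrite big_geq// expr0 mul1r add0r.
rewrite IH big_nat_recr//= -addrA; congr (_ + _).
by rewrite [in LHS](neg_sumS m w2) exprSr; ring.
Qed.

(** As xi_k >= 1, one constant B bounds [neg_sum m w] for all m, so the remainder is at most B /
    2^m; no double series is rearranged. *)
Lemma cvg_neg_sum_pseries w : normc w <= 1 / 2 ->
  (fun m => \sum_(0 <= j < m) neg_sum j 0 * w ^+ j : R[i]^o) @ \oo -->
  (neg_sum 0 w : R[i]^o).
Proof.
move=> w2; have [c H] := neg_term_le w2.
pose B := limn (series (fun k => c * (k.+1%:R ^+ 2)^-1 : R)).
have nB m : normc (neg_sum m w) <= B.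
  apply: normc_lim_le (cvg_neg_sum (m := m) w2); apply: nearW => M.
  rewrite /series /= (le_trans (normc_sum _ _ _))//.
  apply: (@le_trans _ _ (series (fun k => c * (k.+1%:R ^+ 2)^-1) M)).
    by apply: ler_sum => k _; exact: H.
  apply: nondecreasing_cvgn_le (is_cvg_inv_sqr_bound (c := c)) M => p q pq.
  rewrite -subr_ge0 sub_series_geq//.
  by apply: sumr_ge0 => k _; apply: le_trans (H 0%N k); exact: normc_ge0.
have B0 : 0 <= B by apply: le_trans (nB 0%N); exact: normc_ge0.
apply: (@cvgC_le _ _ _ _ (fun m => (1 / 2) ^+ m * B)).
  apply: nearW => m; rewrite (neg_sum_expand m w2) opprD addNKr normc_opp normcM.
  by rewrite ler_pM ?normc_ge0// normcX lerXn2r ?nnegrE ?normc_ge0.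
rewrite -(mul0r B); apply: cvgM; last exact: cvg_cst.
by apply: cvg_expr; rewrite ger0_norm; lra.
Qed.

Lemma isin_neg_sum z : z != 0 -> normc (z ^+ 2) <= 1 / 2 ->
  z / isin a z = - neg_sum 0 (z ^+ 2) /\ isin a z != 0.
Proof.
move=> z0 z2; have := isin_partial_fractions 0 z0 z2; rewrite expr0 mulr1.
have -> : limn (series (limit_term a 0 (z ^+ 2) : nat -> R[i]^o)) = neg_sum 0 (z ^+ 2).
  congr (limn (series _)); apply/funext => k.
  by rewrite /limit_term /neg_term expr0 mulr1 mul1r.
move=> e; have i0 : isin a z != 0.
  by apply: contraNneq z0 => i0; rewrite e i0 oppr0 mul0r.
by split => //; rewrite {1}e mulrAC mulNr mulfV// mulN1r.
Qed.

End Expansion.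

(** * Uniqueness of power series coefficients *)

Section PowerSeriesUniqueness.
Variable R : realType.
Implicit Types (t : R[i]).

Lemma near_dnbhs0P (P : R[i] -> Prop) :
  (\forall t \near (0 : R[i]^o)^', P t) <->
  exists d : R, 0 < d /\ forall t, t != 0 -> normc t <= d -> P t.
Proof.
split => [/nbhs_ballP[e /= e0 H]|[d [d0 H]]].
  have [ei e0'] : e = (complex.Re e)%:C /\ 0 < complex.Re e.
    by move: e0; case: e {H} => x y; rewrite ltcE /= => /andP[/eqP -> ->].
  exists (complex.Re e / 2); split; first by rewrite divr_gt0.
  move=> t t0 td; apply: (H t) => //.
  rewrite -ball_normE /= sub0r normrN normrC ei ltcR.
  by apply: le_lt_trans td _; lra.
apply/nbhs_ballP; exists d%:C => /=; first by rewrite ltcR.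
move=> t; rewrite -ball_normE /= sub0r normrN normrC ltcR => td t0.
by apply: H => //; exact: ltW.
Qed.

(** Convergence at one radius d bounds |c_n| d^n by some B. If the coefficients below m vanish, then
    at t = r d the term of index m is cancelled by a tail of order r^(m+1), so |c_m| d^m <= 2 B r
    for every small r. *)
Lemma pseries_coef_eq0 (c : nat -> R[i]) :
  (\forall t \near (0 : R[i]^o)^',
    series (fun n => c n * t ^+ n : R[i]^o) @ \oo --> (0 : R[i]^o)) ->
  forall n, c n = 0.
Proof.
move=> /near_dnbhs0P[d [d0 H]]; elim/ltn_ind => m IH.
have t0 : d%:C != 0 :> R[i] by rewrite fmorph_eq0 gt_eqF.
have nd : normc (d%:C : R[i]) = d by rewrite normcR ger0_norm// ltW.
have [B [B0 HB]] : exists B : R, 0 <= B /\ forall n, normc (c n) * d ^+ n <= B.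
  have Hd : series (fun n => c n * d%:C ^+ n : R[i]^o) @ \oo --> (0 : R[i]^o).
    by apply: H => //; rewrite nd.
  have cB : exists B : R, forall N, normc (series (fun n => c n * d%:C ^+ n : R[i]^o) N) <= B.
    move/cvgCP: Hd; under eq_fun do rewrite subr0.
    move=> Hd; have /cvg_seq_bounded : cvgn (fun N =>
        normc (series (fun n => c n * d%:C ^+ n : R[i]^o) N)).
      by apply/cvg_ex; exists 0.
    case=> B [_ /(_ (B + 1))]; rewrite ltrDl ltr01 => /(_ isT) HB.
    exists (B + 1) => N; apply: le_trans (HB N I); exact: ler_norm.
  case: cB => B HB; exists (B + B); split.
    by rewrite addr_ge0//; apply: le_trans (HB 0%N); exact: normc_ge0.
  move=> n; rewrite -{1}nd -normcX -normcM.
  have <- := seriesSB (fun n => c n * d%:C ^+ n : R[i]^o) n.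
  by apply: le_trans (normcD _ _) _; rewrite normc_opp lerD.
have key r : 0 < r -> r <= 1 / 2 -> normc (c m) * d ^+ m <= 2 * B * r.
  move=> r0 r2; pose t : R[i] := (r * d)%:C.
  have rd : 0 < r * d by rewrite mulr_gt0.
  have nt : normc t = r * d by rewrite normcR ger0_norm// ltW.
  have Ht : series (fun n => c n * t ^+ n : R[i]^o) @ \oo --> (0 : R[i]^o).
    apply: H; first by rewrite fmorph_eq0 gt_eqF.
    by rewrite nt; nra.
  have tb n : normc (c n * t ^+ n) <= B * r ^+ n.
    rewrite normcM normcX nt exprMn mulrCA mulrC ler_wpM2r// exprn_ge0//.
    exact: ltW.
  (* The factor 1 - r^n, dropped afterwards, makes the induction close; it uses r <= 1/2. *)
  have tail n : \sum_(m.+1 <= k < m.+1 + n) r ^+ k <= 2 * r ^+ m.+1 * (1 - r ^+ n).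
    elim: n => [|n IHn]; first by rewrite addn0 big_geq// expr0 subrr mulr0.
    rewrite addnS big_nat_recr ?leq_addr//= exprD.
    have : 0 <= r ^+ m.+1 * r ^+ n by rewrite mulr_ge0// exprn_ge0// ltW.
    rewrite [r ^+ n.+1]exprSr => h; nra.
  rewrite -(ler_pM2r (exprn_gt0 m r0)).
  have -> : normc (c m) * d ^+ m * r ^+ m = normc (c m * t ^+ m).
    by rewrite normcM normcX nt exprMn; ring.
  have Hm : (fun N => c m * t ^+ m - series (fun n => c n * t ^+ n : R[i]^o) N : R[i]^o)
      @ \oo --> (c m * t ^+ m : R[i]^o).
    rewrite -[X in _ --> X]subr0; apply: cvgB; [exact: cvg_cst|exact: Ht].
  apply: (@normc_lim_le _ _ _ _ _ Hm); near=> N.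
  have mN : (m < N)%N by near: N; exact: nbhs_infty_gt.
  have -> : series (fun n => c n * t ^+ n : R[i]^o) N =
      c m * t ^+ m + \sum_(m.+1 <= k < N) c k * t ^+ k.
    rewrite /series /= (big_cat_nat _ (n := m)) ?(ltnW mN)//=.
    rewrite big_nat_cond big1 ?add0r; last by move=> k /andP[/andP[_ /IH ->] _]; rewrite mul0r.
    by rewrite big_ltn.
  rewrite opprD addNKr normc_opp (le_trans (normc_sum _ _ _))//.
  apply: (@le_trans _ _ (B * \sum_(m.+1 <= k < N) r ^+ k)).
    by rewrite mulr_sumr; apply: ler_sum => k _; exact: tb.
  have -> : 2 * B * r * r ^+ m = B * (2 * r ^+ m.+1) by rewrite exprS; ring.
  rewrite ler_wpM2l//; have := tail (N - m.+1)%N; rewrite subnKC//.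
  have : 0 <= r ^+ m.+1 * r ^+ (N - m.+1) by rewrite mulr_ge0// exprn_ge0// ltW.
  by nra.
apply: eq0_normc; apply/eqP; rewrite eq_le normc_ge0 andbT leNgt; apply/negP => cm.
set s := normc (c m) * d ^+ m.
have s0 : 0 < s by rewrite mulr_gt0// exprn_gt0.
(* Chosen so that 2 B r <= s / 2 < s; B + 1 avoids dividing by zero. *)
pose r := Num.min (1 / 2) (s / (4 * (B + 1))).
have B1 : 0 < 4 * (B + 1) by lra.
have r0 : 0 < r by rewrite /r lt_min divr_gt0//= divr_gt0.
have r2 : r <= 1 / 2 by rewrite /r ge_min lexx.
have r3 : r * (4 * (B + 1)) <= s by rewrite -ler_pdivlMr// /r ge_min lexx orbT.
have := key r r0 r2; rewrite -/s; nra.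
Unshelve. all: by end_near. Qed.

End PowerSeriesUniqueness.

(** * The q-sine function *)

Section QSine.
Variables (R : realType) (q : R).
Hypotheses (q_gt0 : 0 < q) (q_lt1 : q < 1).
Implicit Types (z t h : R[i]).

Definition qweight j : R := (1 - q) * q ^+ j.
Local Notation a := qweight.

Lemma qweight_gt0 j : 0 < a j.
Proof. by rewrite mulr_gt0 ?exprn_gt0// subr_gt0. Qed.

Lemma qweight_sum N : \sum_(0 <= j < N) a j <= 1.
Proof.
suff -> : \sum_(0 <= j < N) a j = 1 - q ^+ N by rewrite gerBl exprn_ge0// ltW.
elim: N => [|N IH]; first by rewrite big_nil subrr.
by rewrite big_nat_recr//= IH /qweight exprS; ring.
Qed.

Local Notation ag := qweight_gt0.
Local Notation asum := qweight_sum.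

Lemma E_qE z : E_q q z = iprod a z.
Proof.
rewrite /E_q /qpoch_infty /iprod.
apply: (congr1 (fun u : nat -> R[i]^o => limn u)); apply/funext => N.
by apply: eq_bigr => j _; rewrite /qweight rmorphM /=; ring.
Qed.

Lemma e_qE z : e_q q z = (iprod a (- z))^-1.
Proof.
rewrite -E_qE /E_q /e_q; congr (qpoch_infty _ _)^-1.
by rewrite mulrN opprK.
Qed.

Lemma Sin_qE z : Sin_q q z = isin a z.
Proof. by rewrite /Sin_q !E_qE. Qed.

(** The Taylor bound puts the difference quotient within |h| e^(|z|+1) of [disin]. *)
Lemma Sin_q'E z : Sin_q' q z = disin a z.
Proof.
rewrite /Sin_q' /derive1. refine (cvg_lim (@norm_hausdorff R[i] (R[i]^o)) _).
apply: (@cvgC_le _ _ _ _ (fun h : R[i]^o => normc (h - 0) * expR (normc z + 1))).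
  apply/near_dnbhs0P; exists 1; split => // h h0 h1.
  rewrite !Sin_qE [h + z]addrC subr0.
  have hp : 0 < normc h.
    rewrite lt_def normc_ge0 andbT; apply: contra_neq h0; exact: eq0_normc.
  rewrite -(ler_pM2l hp) mulrA -expr2 -normcM.
  rewrite (_ : h * _ = isin a (z + h) - isin a z - h * disin a z).
    exact: (isin_taylor ag asum).
  by rewrite mulrBr; congr (_ - _); rewrite -[h^-1 *: _]/(h^-1 * _) mulrA mulfV// mul1r.
rewrite -[X in _ --> X](mul0r (expR (normc z + 1))); apply: cvgM; last exact: cvg_cst.
have : (fun h : R[i]^o => h) @ (0 : R[i]^o)^' --> (0 : R[i]^o) by exact: cvg_within.
by move/cvgCP.
Qed.

(** If the sequences agree below n, then s_n = r_j with j < n would give s_n = s_j; so j >= n and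
    r_n <= s_n, and symmetrically. *)
Lemma increasing_range_inj (u v : nat -> R) :
  increasing_seq u -> increasing_seq v -> range u = range v -> u = v.
Proof.
move=> iu iv uv; apply/funext; elim/ltn_ind => n IH.
have lem (s r : nat -> R) : increasing_seq s -> increasing_seq r ->
    range s = range r -> (forall m, (m < n)%N -> s m = r m) -> r n <= s n.
  move=> is_ ir sr IHs; have : range r (s n) by rewrite -sr; exists n.
  case=> j _ e; rewrite -e (ir n j) leqNgt; apply/negP => jn.
  have := IHs j jn; rewrite e => /eqP; rewrite eq_le !(is_ _ _); lia.
apply/eqP; rewrite eq_le (lem u v iu iv uv IH) (lem v u iv iu (esym uv)) ?andbT//.
by move=> m mn; rewrite IH.
Qed.

Lemma pos_zeroE : pos_zero q = iroot a.
Proof.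
have ex : enumerates_pos_zeros q (iroot a).
  split; first by move=> m n; rewrite (iroot_mono ag asum).
  apply/seteqP; split => [_ [k _ <-]|r [r0 /=]].
    have k0 : 0 < iroot a k by apply: lt_le_trans ltr01 (iroot_ge1 ag asum k).
    by split => //; rewrite Sin_qE (isin_real_eq0 ag asum k0); exists k.
  by rewrite Sin_qE (isin_real_eq0 ag asum r0) => -[k ->]; exists k.
have [i1 r1] := @xgetPex _ (fun=> 0) (enumerates_pos_zeros q) (ex_intro _ _ ex).
have [i2 r2] := ex.
by apply: increasing_range_inj => //; rewrite /pos_zero r1 r2.
Qed.

(** * Values of [eta_q] at even integers *)

Lemma cexp_real (x : R) : cexp x%:C = (expR x)%:C.
Proof. by rewrite /cexp /= cos0 sin0 mulr1. Qed.

Lemma cpow_nat (r : R) n : 0 < r -> cpow r n%:R = r%:C ^+ n.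
Proof.
move=> r0; rewrite /cpow -(rmorph_nat (real_complex R)) -rmorphM cexp_real.
by rewrite expRM_natl lnK ?posrE// rmorphXn.
Qed.

Lemma cpow_oppnat (r : R) n : 0 < r -> cpow r (- n%:R) = (r%:C ^+ n)^-1.
Proof.
move=> r0; rewrite /cpow -(rmorph_nat (real_complex R)) -rmorphN -rmorphM cexp_real.
by rewrite mulNr expRN expRM_natl lnK ?posrE// fmorphV rmorphXn.
Qed.

Lemma eta_q_sum_even n : eta_q_sum q (2 * n)%:R =
  (fun N => 2%:R^-1 * series (neg_term a n 0 : nat -> R[i]^o) N : R[i]^o).
Proof.
apply/funext => N; rewrite /eta_q_sum /series /= mulr_sumr; apply: eq_bigr => k _.
have k0 : 0 < iroot a k by apply: lt_le_trans ltr01 (iroot_ge1 ag asum k).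
rewrite pos_zeroE Sin_q'E cpow_nat// /neg_term mul0r subr0 mulr1.
by move: (disin _ _) => d; rewrite mulKf ?pnatr_eq0// invfM exprM rmorphXn.
Qed.

Lemma eta_q_sum_neg_even n : eta_q_sum q (- (2 * n)%:R) =
  (fun N => 2%:R^-1 * series (limit_term a n 0 : nat -> R[i]^o) N : R[i]^o).
Proof.
apply/funext => N; rewrite /eta_q_sum /series /= mulr_sumr; apply: eq_bigr => k _.
have k0 : 0 < iroot a k by apply: lt_le_trans ltr01 (iroot_ge1 ag asum k).
rewrite pos_zeroE Sin_q'E cpow_oppnat// invrK /limit_term mul0r subr0 mulr1.
by move: (disin _ _) => d; rewrite -mulrA mulKf ?pnatr_eq0// exprM rmorphXn.
Qed.

Lemma cvg_eta_even n : eta_q_sum q (2 * n)%:R @ \oo -->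
  (2%:R^-1 * neg_sum a n 0 : R[i]^o).
Proof.
rewrite eta_q_sum_even.
exact: (cvgCZ (cvg_neg_sum ag asum (m := n) (normc0_le_half R))).
Qed.

Lemma cvg_eta_neg_even n : (0 < n)%N ->
  eta_q_sum q (- (2 * n)%:R) @ \oo --> (0 : R[i]^o).
Proof.
move=> n0; have [c [H _]] := sum_trunc_term ag asum n (normc0_le_half R).
have : (fun N => 2%:R^-1 * series (limit_term a n 0 : nat -> R[i]^o) N : R[i]^o) @ \oo -->
    (2%:R^-1 * limn (series (limit_term a n 0 : nat -> R[i]^o)) : R[i]^o).
  exact: (cvgCZ (is_cvgC_series H (is_cvg_inv_sqr_bound (c := c)))).
by rewrite (sum_limit_term0 ag asum n0) mulr0 eta_q_sum_neg_even.
Qed.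

Lemma eta_q_even n : eta_q q (2 * n)%:R = - (2%:R^-1 * neg_sum a n 0).
Proof.
rewrite /eta_q; congr (- _).
exact: (cvg_lim (@norm_hausdorff R[i] R[i]^o) (@cvg_eta_even n)).
Qed.

Lemma eta_q_neg_even n : (0 < n)%N -> eta_q q (- (2 * n)%:R) = 0.
Proof.
move=> n0; rewrite /eta_q -[RHS]oppr0; congr (- _).
exact: (cvg_lim (@norm_hausdorff R[i] R[i]^o) (cvg_eta_neg_even n0)).
Qed.

(** * The q-Bernoulli coefficients at 1/2 *)

Lemma qfact_neq0 n : (qfact q n)%:C != 0 :> R[i].
Proof.
rewrite fmorph_eq0 gt_eqF// /qfact big_seq_cond; apply: prodr_gt0 => k.
rewrite mem_index_iota andbT => /andP[k0 _].
by rewrite /qint divr_gt0// subr_gt0// exprn_ilt1// ?lt0n -?lt0n// ltW.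
Qed.

(** The generating function at 1/2 is even in t, and z = t / (2i) gives z^2 = - t^2 / 4, hence the
    powers of -1/4. *)
Definition qbern_coef n : R[i] :=
  if odd n then 0
  else (qfact q n)%:C * - (neg_sum a n./2 0 * (- 4%:R^-1) ^+ n./2).

Lemma iprod0 : iprod a 0 = 1.
Proof.
apply: (cvgC_unique (cvg_pprod ag asum (z := 0))).
apply: (@cvg_near_cst _ _ (1 : R[i]^o)); apply: nearW => N.
by rewrite /pprod big1// => j _; rewrite mulr0 addr0.
Qed.

(** The product is 1 at 0 and Lipschitz near it. Nonvanishing is what allows the inverse defining
    [e_q] to be cleared. *)
Lemma iprod_neq0_near : exists d : R, 0 < d /\
  forall z, normc z <= d -> iprod a z != 0.
Proof.
pose e := 2 * expR (normc (0 : R[i]) + 1) : R.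
have e1 : 1 <= expR (normc (0 : R[i]) + 1) :> R.
  by rewrite normc0 add0r; apply: le_trans (expR_ge1Dx 1); lra.
exists (1 / (2 * e)); split; first by rewrite divr_gt0// mulr_gt0// /e; lra.
move=> z; rewrite ler_pdivlMr; last by rewrite mulr_gt0// /e; lra.
move=> ze; have z1 : normc z <= 1.
  by have := normc_ge0 z; rewrite /e in ze; nra.
have H : normc (iprod a (0 + z) - iprod a 0) <= normc z * e.
  apply: (@normc_lim_le _ (fun N => pprod (fun j => (a j)%:C) N (0 + z) -
      pprod (fun j => (a j)%:C) N 0 : R[i]^o)).
    by apply: nearW => N; exact: (pprod_lipschitz ag asum).
  by apply: cvgB; exact: (cvg_pprod ag asum).
rewrite add0r iprod0 in H; apply/eqP => z0; move: H.
by rewrite z0 sub0r normc_opp normc1; lra.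
Qed.

(** Exactly [uphalf N] indices below N are even. *)
Lemma qbern_coef_partial_sum t N :
  \sum_(0 <= n < N) qbern_coef n * (t ^+ n / (qfact q n)%:C) =
  - \sum_(0 <= j < uphalf N) neg_sum a j 0 * (- (t ^+ 2) / 4%:R) ^+ j.
Proof.
elim: N => [|N IH]; first by rewrite !big_geq ?oppr0.
rewrite big_nat_recr//= IH /qbern_coef uphalf_half.
have [oN|eN] := boolP (odd N).
  by rewrite mul0r addr0 add1n.
rewrite add0n [in RHS]big_nat_recr//= opprD; congr (_ + _).
have -> : t ^+ N = (t ^+ 2) ^+ N./2.
  by rewrite -exprM mul2n; congr (_ ^+ _); move: eN; lia.
have q0 := qfact_neq0 N.
have -> : - t ^+ 2 / 4%:R = t ^+ 2 * - 4%:R^-1 by rewrite mulrN mulNr.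
rewrite [(t ^+ 2 * _) ^+ _]exprMn.
move: ((t ^+ 2) ^+ N./2) ((- _) ^+ N./2) (neg_sum _ _ _) => x y s.
by move: q0; move: (qfact q N)%:C => f f0; field.
Qed.

Lemma qbern_coef_expansion : qbernoulli_expansion q (1 / 2%:R) qbern_coef.
Proof.
have [d [d0 Hd]] := iprod_neq0_near.
apply/near_dnbhs0P; exists (Num.min 1 d); split; first by rewrite lt_min ltr01.
move=> t t0; rewrite le_min => /andP[t1 td].
pose w := - (t ^+ 2) / 4%:R; pose z := t / (2%:R * 'i%C).
have ni : (2%:R * 'i%C : R[i]) != 0.
  by rewrite mulf_neq0 ?pnatr_eq0//; exact: neq0Ci.
have zw : z ^+ 2 = w.
  by rewrite /z /w expr_div_n exprMn sqr_i; field.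
have z0 : z != 0 by rewrite mulf_neq0// invr_eq0.
have w2 : normc w <= 1 / 2.
  rewrite normcM normc_opp normcX normcV normc_nat.
  have : normc t ^+ 2 <= 1 by rewrite exprn_ile1 ?normc_ge0.
  lra.
have iz : 'i%C * z = t / 2%:R by rewrite /z; field; exact: neq0Ci.
have [zi i0] : z / isin a z = - neg_sum a 0 w /\ isin a z != 0.
  by rewrite -zw; apply: (isin_neg_sum ag asum z0); rewrite zw.
(* As e_q(t/2) = 1 / E_q(-t/2), multiplying through by E_q(-t/2) gives t / (E_q(t/2) - E_q(-t/2)),
   which is z / isin z. *)
have -> : t * e_q q (t * (1 / 2%:R)) /
    (e_q q (t / 2%:R) * E_q q (t / 2%:R) - 1) = - neg_sum a 0 w.
  have En : iprod a (- (t / 2%:R)) != 0.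
    apply: Hd; rewrite normc_opp normcM normcV normc_nat.
    by have := normc_ge0 t; lra.
  rewrite -zi mul1r !e_qE E_qE.
  have Ed : iprod a (t / 2%:R) - iprod a (- (t / 2%:R)) = 2%:R * 'i%C * isin a z.
    by rewrite /isin iz [RHS]mulrC divfK.
  have nz : iprod a (t / 2%:R) - iprod a (- (t / 2%:R)) != 0.
    by rewrite Ed mulf_neq0.
  have -> : z / isin a z = t / (iprod a (t / 2%:R) - iprod a (- (t / 2%:R))).
    by rewrite Ed /z [in RHS]invfM mulrA.
  by field; rewrite En nz.
have h : (fun m => \sum_(0 <= j < m) neg_sum a j 0 * w ^+ j : R[i]^o) @ \oo -->
  (neg_sum a 0 w : R[i]^o) := cvg_neg_sum_pseries ag asum w2.
have uh : (fun N : nat => uphalf N) @ \oo --> \oo.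
  apply/cvgnyPge => A; near=> N.
  have : (A.*2 <= N)%N by near: N; exact: nbhs_infty_ge.
  move=> /half_leq; rewrite doubleK uphalf_half => /leq_trans; apply.
  exact: leq_addl.
rewrite (_ : series _ = fun N => - \sum_(0 <= j < uphalf N) neg_sum a j 0 * w ^+ j).
  exact: (cvgN (cvg_comp _ _ uh h)).
by apply/funext => N; rewrite /series /= qbern_coef_partial_sum.
Unshelve. all: by end_near. Qed.

Lemma qbernoulli_expansion_inj (x : R[i]) (b c : nat -> R[i]) :
  qbernoulli_expansion q x b -> qbernoulli_expansion q x c -> b = c.
Proof.
move=> hb hc; apply/funext => n; apply/eqP; rewrite -subr_eq0; apply/eqP.
suff : (b n - c n) / (qfact q n)%:C = 0.
  by move/eqP; rewrite mulf_eq0 invr_eq0 (negbTE (qfact_neq0 n)) orbF => /eqP.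
apply: (@pseries_coef_eq0 R (fun n => (b n - c n) / (qfact q n)%:C)).
apply: filterS2 hb hc => t hb hc.
rewrite (_ : series _ = fun N =>
    series (fun n => b n * (t ^+ n / (qfact q n)%:C) : R[i]^o) N -
    series (fun n => c n * (t ^+ n / (qfact q n)%:C) : R[i]^o) N).
  exact: cvgCB0 hb hc.
apply/funext => N; rewrite /series /= -sumrB; apply: eq_bigr => k _.
by rewrite mulrAC -mulrA mulrBl.
Qed.

Lemma qbernoulliE n : qbernoulli q n (1 / 2%:R) = qbern_coef n.
Proof.
rewrite /qbernoulli.
have h := @xgetPex _ (fun=> 0) (qbernoulli_expansion q (1 / 2%:R))
  (ex_intro _ _ qbern_coef_expansion).
by rewrite (qbernoulli_expansion_inj h qbern_coef_expansion).
Qed.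

End QSine.

Theorem proposition5p15 (R : realType) (q : R) (q_gt0 : 0 < q) (q_lt1 : q < 1) :
  (forall n : nat,
      cvgn (eta_q_sum q (2 * n)%:R) /\
      eta_q q (2 * n)%:R =
        (2%:R : R[i]) ^ ((2 * n)%:Z - 1) * (-1) ^+ n *
        (qbernoulli q (2 * n) (1 / 2%:R) / (qfact q (2 * n))%:C)) /\
  (forall n : nat, (0 < n)%N ->
      cvgn (eta_q_sum q (- (2 * n)%:R)) /\
      eta_q q (- (2 * n)%:R) = 0).
Proof.
split=> n; last first.
  move=> n0; split; last exact: eta_q_neg_even.
  by apply/cvg_ex; exists 0; exact: cvg_eta_neg_even.
split; first by apply/cvg_ex; eexists; exact: cvg_eta_even.
rewrite eta_q_even// qbernoulliE// /qbern_coef mul2n odd_double doubleK.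
have q0 := qfact_neq0 q_gt0 q_lt1 n.*2.
rewrite [(qfact _ _)%:C * _ / _]mulrAC mulfV// mul1r.
have n2 : (2%:R : R[i]) != 0 by rewrite pnatr_eq0.
(* The exponent is an integer, equal to -1 at n = 0. The power 4^n (-1)^n then cancels the (-1/4)^n
   of [qbern_coef]. *)
have -> : (2%:R : R[i]) ^ (n.*2%:Z - 1) = 4%:R ^+ n / 2%:R.
  rewrite expfzDr// exprN1 -exprnP -mul2n exprM.
  by congr (_ ^+ n * _); ring.
have e1 : (4%:R : R[i]) ^+ n * (-1) ^+ n * (- 4%:R^-1) ^+ n = 1.
  rewrite -!exprMn (_ : _ * _ * _ = 1) ?expr1n//.
  by field.
move: (neg_sum _ _ _) (4%:R ^+ n) ((-1) ^+ n) ((- 4%:R^-1) ^+ n) e1 => s x y v e1.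
have -> : x / 2%:R * y * - (s * v) = - (2%:R^-1 * s) * (x * y * v) by ring.
by rewrite e1 mulr1.
Qed.
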